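(* Let $X$ be an $n\times n$ Hermitian random matrix whose entries $X_{ij}=(X_{ji})^*$ are independent for $i\ge j$, with $X_{ij}\sim N_{\mathbb{C}}(0,b_{ij}^2)$ for $i>j$ and $X_{ii}\sim N_{\mathbb{R}}(0,b_{ii}^2)$, where $b_{ij}=b_{ji}\ge 0$ are arbitrary nonnegative scalars. Let $$\sigma^2:=\max_{i\le n}\sum_{j\le n} b_{ij}^2,\qquad \sigma_*^2:=\max_{i,j\le n} b_{ij}^2.$$ Then $$\mathbf{P}\big[\|X\|>2\sigma+\sigma_*(1+t)\big]\le 2n\,e^{-t^2/2}$$ for every $t\ge 0$.
   Context: $N_{\mathbb{R}}(0,s^2)$ is the real centered Gaussian law with variance $s^2$. $N_{\mathbb{C}}(0,s^2)$ is the law of a complex random variable whose real and imaginary parts are independent with law $N_{\mathbb{R}}(0,s^2/2)$. For a scalar, $a^*$ is the complex conjugate. $\|X\|$ is the spectral norm (largest singular value). $\sigma,\sigma_*$ denote the nonnegative square roots. *)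

(* Defs.v *)
From HB Require Import structures.
From mathcomp Require Import all_boot all_order all_algebra.
From mathcomp Require Import spectral sesquilinear complex.
From mathcomp Require Import all_classical all_reals all_analysis.

Set Implicit Arguments.
Unset Strict Implicit.
Unset Printing Implicit Defensive.

Import Order.TTheory GRing.Theory Num.Theory.
Import numFieldNormedType.Exports.

Local Open Scope classical_set_scope.
Local Open Scope ring_scope.
Local Open Scope sesquilinear_scope.

(* Parametrized by the standard deviation s. The degenerate case is separate
   because the library's [normal_prob m 0] is the uniform law on [0, 1]. *)
Definition gaussR (R : realType) (s : R) : set R -> \bar R :=
  if s == 0 then \d_(0 : R) else normal_prob 0 s.

Definition has_law (d d' : measure_display) (T : measurableType d)
    (T' : measurableType d') (R : realType) (P : probability T R)
    (Z : T -> T') (mu : set T' -> \bar R) : Prop :=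
  measurable_fun setT Z /\
  forall A : set T', measurable A -> P (Z @^-1` A) = mu A.

Definition independent_pair (d d1 d2 : measure_display) (T : measurableType d)
    (T1 : measurableType d1) (T2 : measurableType d2) (R : realType)
    (P : probability T R) (Y : T -> T1) (Z : T -> T2) : Prop :=
  forall (A : set T1) (B : set T2), measurable A -> measurable B ->
    P (Y @^-1` A `&` Z @^-1` B) = (P (Y @^-1` A) * P (Z @^-1` B))%E.

Definition independent_family (d d' : measure_display) (T : measurableType d)
    (T' : measurableType d') (R : realType) (P : probability T R)
    (I : finType) (D : {set I}) (Z : I -> T -> T') : Prop :=
  forall (J : {set I}) (A : I -> set T'), J \subset D ->
    (forall k, k \in J -> measurable (A k)) ->
    P (\bigcap_(k in [set` J]) (Z k @^-1` A k)) =
    (\prod_(k in J) P (Z k @^-1` A k))%E.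

(* Z ~ N_C(0, s^2) : variance s^2 / 2 for each of the two parts. *)
Definition is_gaussC (d : measure_display) (T : measurableType d)
    (R : realType) (P : probability T R) (Z : T -> R[i]) (s : R) : Prop :=
  [/\ has_law P (fun w => complex.Re (Z w)) (gaussR (s / Num.sqrt 2)),
      has_law P (fun w => complex.Im (Z w)) (gaussR (s / Num.sqrt 2)) &
      independent_pair P (fun w => complex.Re (Z w))
                         (fun w => complex.Im (Z w))].

(* The Borel structure of R[i] is taken to be that of R * R. *)
Definition ReIm (R : realType) (z : R[i]) : R * R :=
  (complex.Re z, complex.Im z).

Definition gaussian_hermitian (d : measure_display) (T : measurableType d)
    (R : realType) (P : probability T R) (n : nat) (b : 'M[R]_n)
    (X : T -> 'M[R[i]]_n) : Prop :=
  [/\ forall w (i j : 'I_n), X w i j = Num.conj (X w j i),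
      independent_family P [set ij : 'I_n * 'I_n | (ij.2 <= ij.1)%N]%SET
        (fun ij w => ReIm (X w ij.1 ij.2)),
      forall i j : 'I_n, (j < i)%N -> is_gaussC P (fun w => X w i j) (b i j) &
      (* the imaginary part of a diagonal entry is 0 by the first clause *)
      forall i : 'I_n,
        has_law P (fun w => complex.Re (X w i i)) (gaussR (b i i))].

Definition singular_values (R : realType) (m n : nat) (A : 'M[R[i]]_(m, n)) :
    set R :=
  [set s | 0 <= s /\ eigenvalue (A ^t* *m A) (real_complex R (s ^+ 2))].

Definition spectral_norm (R : realType) (m n : nat) (A : 'M[R[i]]_(m, n)) : R :=
  sup (singular_values A).

Definition sigma (R : realType) (n : nat) (b : 'M[R]_n) : R :=
  Num.sqrt (\big[Num.max/0]_(i < n) \sum_(j < n) b i j ^+ 2).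

Definition sigma_star (R : realType) (n : nat) (b : 'M[R]_n) : R :=
  Num.sqrt (\big[Num.max/0]_(i < n) \big[Num.max/0]_(j < n) b i j ^+ 2).

(* Main.v *)
(** By the Wick formula, E Tr X^L is a sum over closed walks of length L of Wick
    sums of matrix entries.  Fix the starting point r of a walk and record, for
    every other visited vertex, the last step leaving it: these steps form a tree
    rooted at r.  The remaining steps only matter through the number of times each
    vertex is left, and summing over their endpoints replaces the corresponding
    entries by the row sums S_a of X, for which E[S_a S_b] = b_ab^2 <= sigma_*^2.
    As two tree edges are never correlated, each of them is paired with a row sum,
    and the sum over the trees with j labelled edges gives at most sigma^(2j).  Thus
      E Tr X^(2p) <= n \sum_j sigma^(2j) C(2p, j) (2p-j)...(2p-2j+1) / j! * m_(2p-2j)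
    with m_k the k-th moment of N_R(0, sigma_*^2).  Summing against
    theta^(2p) / (2p)! yields E Tr cosh(theta X) <= n exp(2 theta sigma +
    theta^2 sigma_*^2 / 2), and the tail bound follows from Markov's inequality
    with theta = t / sigma_*. *)

Require Import Defs.
From HB Require Import structures.
From mathcomp Require Import all_boot all_order all_algebra.
From mathcomp Require Import boolp ring.

Set Implicit Arguments.
Unset Strict Implicit.
Unset Printing Implicit Defensive.

Import Order.TTheory GRing.Theory Num.Theory.

Local Open Scope ring_scope.

(** * Wick sums *)

(** A walk is recovered from the ordered lists of exits of its vertices. Once the tree of last exits
    and the number of other exits of each vertex are fixed, the other endpoints may be summed
    freely: lists that do not chain into a walk only add nonnegative Wick sums. So pairings never
    have to be sorted by their topology. There are C(2p, j) ways to distribute the 2p - j other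
    exits over j + 1 vertices, and the falling factorial counts the row sums that the j edges are
    paired with. The 1/j! is the price of labelling the vertices: a set of size j has j! labellings,
    and dropping injectivity of the labels lets the leaves be summed one by one. Divided by (2p)!,
    the coefficient splits into sigma^(2j) / j!^2 times (sigma_*^2 / 2)^(p-j) / (p-j)!. The
    generating function is thus dominated by the product of the Bessel series I_0(2 theta sigma),
    which is at most exp(2 theta sigma), and of exp(theta^2 sigma_*^2 / 2). *)

Section Wick.
Variables (A : comPzRingType) (L : eqType) (c : L -> L -> A).
Hypothesis c_sym : forall x y, c x y = c y x.

(* [k] is fuel: the recursive call is on [rem y l']. *)
Fixpoint wick_rec (k : nat) (l : seq L) : A :=
  match l, k with
  | [::], _ => 1
  | _ :: _, 0%N => 0
  | x :: l', k'.+1 => \sum_(y <- l') c x y * wick_rec k' (rem y l')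
  end.

Definition wick (l : seq L) : A := wick_rec (size l) l.

Lemma wick_rec_fuel k m l : (size l <= m)%N -> (size l <= k)%N ->
  wick_rec k l = wick_rec m l.
Proof.
elim: k m l => [|k IH] [|m] [|x l] //= lm lk.
apply: eq_big_seq => y yl; congr (_ * _); apply: IH; rewrite size_rem // -ltnS;
  exact: leq_ltn_trans (leq_pred _) _.
Qed.

Lemma wick_rec_wick k l : (size l <= k)%N -> wick_rec k l = wick l.
Proof. exact: wick_rec_fuel. Qed.

Lemma wick_nil : wick [::] = 1. Proof. by []. Qed.

Lemma wick_cons x l : wick (x :: l) = \sum_(y <- l) c x y * wick (rem y l).
Proof.
rewrite /wick /=; apply: eq_big_seq => y yl; congr (_ * _).
by apply: wick_rec_wick; rewrite size_rem // leq_pred.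
Qed.

Lemma perm_rem (l l' : seq L) y : perm_eq l l' -> perm_eq (rem y l) (rem y l').
Proof.
move=> ll'; have [yl|yl] := boolP (y \in l); last first.
  by rewrite !rem_id // -(perm_mem ll').
rewrite -(perm_cons y); apply: perm_trans (perm_to_rem _); last first.
  by rewrite -(perm_mem ll').
by apply: perm_trans ll'; rewrite perm_sym perm_to_rem.
Qed.

Definition perm_inv (U : Type) (F : seq L -> U) :=
  forall l l', perm_eq l l' -> F l = F l'.

Lemma rem_remC (l : seq L) y z : perm_eq (rem z (rem y l)) (rem y (rem z l)).
Proof.
apply/permP => a; have [->//|yz] := eqVneq y z.
rewrite !count_rem.
have -> : (z \in rem y l) = (z \in l).
  have [yl|/rem_id -> //] := boolP (y \in l).
  by rewrite (perm_mem (perm_to_rem yl)) inE eq_sym (negbTE yz).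
have -> : (y \in rem z l) = (y \in l).
  have [zl|/rem_id -> //] := boolP (z \in l).
  by rewrite (perm_mem (perm_to_rem zl)) inE (negbTE yz).
by rewrite -!subnDA [X in (_ - X)%N]addnC.
Qed.

Lemma sum_rem_cons (f : L -> A) (F : seq L -> A) x l : perm_inv F ->
  \sum_(y <- x :: l) f y * F (rem y (x :: l)) =
  f x * F l + \sum_(y <- l) f y * F (x :: rem y l).
Proof.
move=> pF; rewrite big_cons /= eqxx; congr (_ + _).
apply: eq_big_seq => y yl; have [->|//] := eqVneq x y.
by congr (_ * _); apply: pF; exact: perm_to_rem.
Qed.

Lemma sum_rem (f : L -> A) x l : x \in l ->
  \sum_(y <- rem x l) f y = \sum_(y <- l) f y - f x.
Proof.
by move=> xl; rewrite (perm_big _ (perm_to_rem xl)) big_cons /= [RHS]addrC addKr.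
Qed.

(** The recursion singles out the head, so the point is that the first two letters commute; words
    with different heads are reduced to this case through a common remainder [u]. *)
Lemma wick_perm : perm_inv wick.
Proof.
move=> l; have [k] := ubnP (size l); elim: k l => // k IH [|x l] /= lk l' ll'.
  by have /perm_nilP -> : perm_eq l' [::] by rewrite perm_sym.
have tl (z : L) u v : (size u < k)%N -> perm_eq u v -> wick (z :: u) = wick (z :: v).
  move=> uk uv; rewrite !wick_cons (perm_big _ uv); apply: eq_big_seq => y yv.
  congr (_ * _); apply: IH; last exact: perm_rem.
  by apply: leq_ltn_trans uk; rewrite size_rem ?leq_pred // (perm_mem uv).
rewrite ltnS in lk.
case: l' ll' => [|x' l' ll']; first by move/perm_nilP.
have [xx'|xx'] := eqVneq x x'.
  by move: ll'; rewrite xx' perm_cons; exact: tl.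
have xl' : x \in l'.
  have := mem_head x l; rewrite (perm_mem ll') inE (negbTE xx') /=; done.
have [u l'u] : exists u, perm_eq l' (x :: u).
  by exists (rem x l'); exact: perm_to_rem.
have lu : perm_eq l (x' :: u).
  rewrite -(perm_cons x); apply: (perm_trans ll').
  rewrite -(perm_cons x') in l'u; apply: (perm_trans l'u).
  by apply/permP => a /=; rewrite addnCA.
have lk' : size l = (size u).+1 by rewrite (perm_size lu).
have uk : (size u < k)%N by apply: ltnW; rewrite -lk'.
rewrite (tl x l (x' :: u) lk lu) (tl x' l' (x :: u) _ l'u); last first.
  by rewrite (perm_size l'u) /= -lk'.
(* Cut off at the lengths covered by the induction hypothesis, so that [F] is invariant on all
   words, as [sum_rem_cons] demands. *)
pose F s := if (size s < k)%N then wick s else 0.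
have pF : perm_inv F.
  by move=> s s' ss'; rewrite /F (perm_size ss'); case: ifP => // ?; apply: IH; rewrite ?(perm_size ss').
have sz (s : seq L) y : y \in s -> size (rem y s) = (size s).-1 by move=> ys; rewrite size_rem.
(* Either [z] and [z'] are paired together, or with letters of [u] at two positions; the subtracted
   sum removes the case of equal positions. *)
have swap z z' : wick [:: z, z' & u] = c z z' * wick u +
    (\sum_(y <- u) \sum_(y' <- u) c z y * c z' y' * F (rem y' (rem y u)) -
     \sum_(y <- u) c z y * c z' y * F (rem y (rem y u))).
  rewrite wick_cons.
  rewrite (eq_big_seq (fun y => c z y * F (rem y (z' :: u)))); last first.
    by move=> y yu; rewrite /F sz //= uk.
  rewrite sum_rem_cons // {1}/F uk; congr (_ + _).
  rewrite -sumrB; apply: eq_big_seq => y yu; rewrite -sum_rem //.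
  have yu0 : (0 < size u)%N by case: (u) yu.
  rewrite /F /= sz // prednK // uk wick_cons mulr_sumr.
  apply: eq_big_seq => y' y'u; rewrite mulrA !sz // ifT //.
  by apply: leq_ltn_trans uk; exact: leq_trans (leq_pred _) (leq_pred _).
rewrite !swap c_sym; congr (_ + (_ - _)); last first.
  by apply: eq_bigr => y _; rewrite (mulrC (c x y)).
rewrite exchange_big /=; apply: eq_bigr => y _; apply: eq_bigr => y' _.
by rewrite (mulrC (c x y')) (pF _ _ (rem_remC _ _ _)).
Qed.
End Wick.

Lemma wick_rmorph (A A' : comPzRingType) (f : {rmorphism A -> A'}) (L : eqType)
  (c : L -> L -> A) l : f (wick c l) = wick (fun x y => f (c x y)) l.
Proof.
have [k] := ubnP (size l); elim: k l => // k IH [|x l] /= lk.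
  by rewrite !wick_nil rmorph1.
rewrite !wick_cons rmorph_sum big_seq [RHS]big_seq; apply: eq_bigr => y yl.
by rewrite rmorphM IH // size_rem // (leq_ltn_trans (leq_pred _)).
Qed.

Lemma eq_wick (A : comPzRingType) (L : eqType) (c c' : L -> L -> A) l :
  (forall x y, c x y = c' x y) -> wick c l = wick c' l.
Proof.
move=> cc'; have [k] := ubnP (size l); elim: k l => // k IH [|x l] //= lk.
rewrite !wick_cons big_seq [RHS]big_seq; apply: eq_bigr => y yl.
by rewrite cc' IH // size_rem // (leq_ltn_trans (leq_pred _)).
Qed.

(** * Multilinearity of Wick sums *)

Section Expansion.
Variables (A : comPzRingType) (L L' : eqType) (B : finType).
Variables (alpha : L -> B -> A) (e : L -> B -> L').
Implicit Types (w : seq L) (F : seq L' -> A).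

(* Multilinear expansion of a word whose letter [x] stands for the linear
   combination [\sum_b alpha x b * e x b]. *)
Fixpoint multiexpand w F : A :=
  if w is x :: w' then \sum_b alpha x b * multiexpand w' (fun l => F (e x b :: l))
  else F [::].

Lemma eq_multiexpand w F F' : (forall l, F l = F' l) -> multiexpand w F = multiexpand w F'.
Proof.
elim: w F F' => [|x w IH] F F' FF' /=; first exact: FF'.
by apply: eq_bigr => b _; congr (_ * _); apply: IH => l; exact: FF'.
Qed.

Lemma multiexpandD w F F' : multiexpand w (fun l => F l + F' l) = multiexpand w F + multiexpand w F'.
Proof.
elim: w F F' => [|x w IH] F F' //=.
by rewrite -big_split; apply: eq_bigr => b _; rewrite /= -mulrDr -IH.
Qed.

Lemma multiexpandZ w F c : multiexpand w (fun l => c * F l) = c * multiexpand w F.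
Proof.
elim: w F => [|x w IH] F //=.
by rewrite mulr_sumr; apply: eq_bigr => b _; rewrite IH mulrCA.
Qed.

Lemma multiexpand_rem x w F : perm_inv F -> x \in w -> multiexpand w F = multiexpand (x :: rem x w) F.
Proof.
elim: w F => // z w IH F pF; rewrite inE.
have [-> _|xz] := eqVneq x z; first by rewrite [in RHS]/= eqxx.
move=> /= xw; rewrite [in RHS]eq_sym (negbTE xz) /=.
have E b : multiexpand w (fun l => F (e z b :: l)) =
    \sum_b' alpha x b' * multiexpand (rem x w) (fun l => F (e z b :: e x b' :: l)).
  by rewrite IH // => l l' ll'; apply: pF; rewrite perm_cons.
under eq_bigr do rewrite E mulr_sumr.
rewrite exchange_big /=; apply: eq_bigr => b' _.
rewrite mulr_sumr; apply: eq_bigr => b _; rewrite mulrCA; congr (_ * (_ * _)).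
apply: eq_multiexpand => l; apply: pF.
by rewrite -[X in perm_eq X _]/([:: e z b; e x b'] ++ l) -[X in perm_eq _ X]/([:: e x b'; e z b] ++ l) perm_cat2r; apply/permP => a /=; rewrite addnCA.
Qed.

(** Choosing a partner in the expanded word amounts to choosing a letter [y] of [w], contracting its
    whole linear combination, and expanding the other letters. *)
Lemma multiexpand_sum_rem w F d : perm_inv F ->
  multiexpand w (fun l => \sum_(y <- l) d y * F (rem y l)) =
  \sum_(y <- w) (\sum_b alpha y b * d (e y b)) * multiexpand (rem y w) F.
Proof.
elim: w F => [|z w IH] F pF /=; first by rewrite !big_nil.
have pF' b : perm_inv (fun l => F (e z b :: l)).
  by move=> l l' ll'; apply: pF; rewrite perm_cons.
under eq_bigr => b _.
  rewrite (@eq_multiexpand _ _ (fun l => d (e z b) * F l + \sum_(y <- l) d y * F (e z b :: rem y l))); last first.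
    by move=> l; exact: (sum_rem_cons d (e z b) l pF).
  rewrite multiexpandD multiexpandZ (IH (fun l => F (e z b :: l))) // mulrDr mulrA mulr_sumr; over.
rewrite big_split /= -mulr_suml big_cons eqxx; congr (_ + _).
rewrite exchange_big /=; apply: eq_big_seq => y yw.
have -> : (if z == y then w else z :: rem y w) = rem y (z :: w) by [].
have -> : multiexpand (rem y (z :: w)) F = multiexpand (z :: rem y w) F.
  by rewrite /=; have [->|//] := eqVneq z y; rewrite (multiexpand_rem pF yw).
by rewrite /= mulr_sumr; apply: eq_bigr => b _; rewrite mulrCA.
Qed.

(** Contracting the head commutes with expanding the rest. This carries the Wick formula from
    independent real Gaussians over to the complex entries. *)
Lemma multiexpand_wick (c' : L' -> L' -> A) w : (forall x y, c' x y = c' y x) ->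
  multiexpand w (wick c') =
  wick (fun x y => \sum_b alpha x b * \sum_b' alpha y b' * c' (e x b) (e y b')) w.
Proof.
move=> c_sym; have [k] := ubnP (size w); elim: k w => // k IH [|x w] //= wk.
rewrite wick_cons; under eq_bigr => b _.
  rewrite (@eq_multiexpand _ _ (fun l => \sum_(y <- l) c' (e x b) y * wick c' (rem y l))); last first.
    by move=> l; rewrite wick_cons.
  rewrite multiexpand_sum_rem; last exact: wick_perm.
  rewrite mulr_sumr; over.
rewrite exchange_big /=; apply: eq_big_seq => y yw.
rewrite mulr_suml; apply: eq_bigr => b _; rewrite mulrA; congr (_ * _).
by rewrite IH // size_rem // (leq_ltn_trans (leq_pred _)).
Qed.
End Expansion.

(** * Closed walks and last-exit trees *)

Section WickOrder.
Variables (R : numDomainType) (L : eqType) (c : L -> L -> R).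

Lemma wick_ge0 l : (forall x y, 0 <= c x y) -> 0 <= wick c l.
Proof.
move=> c_ge0; have [k] := ubnP (size l); elim: k l => // k IH [|x l] /= lk.
  by rewrite wick_nil ler01.
rewrite wick_cons big_seq sumr_ge0 // => y yl; rewrite mulr_ge0 // IH //.
by rewrite size_rem // (leq_ltn_trans (leq_pred _)).
Qed.
End WickOrder.

(** * Sums over multisets *)

Section CompleteHomogeneous.
Variables (R : numDomainType) (I : eqType).
Implicit Types (s y : seq I) (F G : seq I -> R).

(* Sum of [F] over the multisets of [m] letters of [s], each listed in the order
   of [s]. *)
Fixpoint hsum s (m : nat) F : R :=
  if s is a :: s' then
    \sum_(i < m.+1) hsum s' (m - i) (fun y => F (nseq i a ++ y))
  else (m == 0)%:R * F [::].

Lemma eq_hsum s m F G : (forall y, size y = m -> F y = G y) ->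
  hsum s m F = hsum s m G.
Proof.
elim: s m F G => [|a s IH] m F G FG /=.
  by case: eqP => [m0|_]; rewrite ?mul0r // FG ?m0.
apply: eq_bigr => i _; apply: IH => y sy.
by rewrite FG // size_cat size_nseq sy subnKC // -ltnS.
Qed.

Lemma hsum_le s m F G : (forall y, size y = m -> F y <= G y) ->
  hsum s m F <= hsum s m G.
Proof.
elim: s m F G => [|a s IH] m F G FG /=.
  by case: eqP => [m0|_]; rewrite ?mul0r // !mul1r FG ?m0.
apply: ler_sum => i _; apply: IH => y sy.
by rewrite FG // size_cat size_nseq sy subnKC // -ltnS.
Qed.

Lemma hsum_ge0 s m F : (forall y, 0 <= F y) -> 0 <= hsum s m F.
Proof.
by elim: s m F => [|a s IH] m F FG /=; [rewrite mulr_ge0|rewrite sumr_ge0 // => i _; exact: IH].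
Qed.

Lemma hsum_sum (T : Type) (r : seq T) (P : pred T) s m (F : T -> seq I -> R) :
  \sum_(t <- r | P t) hsum s m (F t) = hsum s m (fun y => \sum_(t <- r | P t) F t y).
Proof.
elim: s m F => [|a s IH] m F /=; first by rewrite mulr_sumr.
by rewrite exchange_big /=; apply: eq_bigr => i _; rewrite IH.
Qed.

Lemma hsumZ s m F c : hsum s m (fun y => c * F y) = c * hsum s m F.
Proof.
elim: s m F => [|a s IH] m F /=; first by rewrite mulrCA.
by rewrite mulr_sumr; apply: eq_bigr => i _; rewrite IH.
Qed.

Lemma hsum0 s F : hsum s 0 F = F [::].
Proof.
by elim: s F => [|a s IH] F /=; rewrite ?mul1r // big_ord_recl big_ord0 addr0 IH.
Qed.

Lemma hsum_head a s m F : hsum (a :: s) m.+1 F =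
  hsum (a :: s) m (fun y => F (a :: y)) + hsum s m.+1 F.
Proof. by rewrite /= big_ord_recl addrC subn0. Qed.

(** A multiset either uses the letter [a], and one copy is taken out, or lives on the other letters.
    In [vwalks_le_trees] these cases become the non-last and the last exit from [a]. *)
Lemma hsum_rem a s m F : perm_inv F -> a \in s ->
  hsum s m.+1 F = hsum s m (fun y => F (a :: y)) + hsum (rem a s) m.+1 F.
Proof.
elim: s m F => // b s IH m F pF; rewrite inE.
have [-> _|ab] := eqVneq a b; first by rewrite hsum_head /= eqxx.
rewrite /= eq_sym (negbTE ab) /= => as_.
rewrite big_ord_recr [in X in _ + X]big_ord_recr /= !subnn !hsum0 addrA.
congr (_ + _); rewrite -big_split; apply: eq_bigr => i _ /=.
rewrite subSn -1?ltnS // IH //; last by move=> l l' ll'; apply: pF; rewrite perm_cat2l.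
congr (_ + _); apply: eq_hsum => y _; apply: pF.
by rewrite perm_catC /= perm_cons perm_catC.
Qed.

(** Stars and bars; [hsum_head] is Pascal's rule. *)
Lemma hsum_cst a s m c : hsum (a :: s) m (fun=> c) = c *+ 'C(m + size s, m).
Proof.
elim: s a m => [|b s IHs] a m.
  rewrite /= addn0 binn big_ord_recr /= subnn mul1r big1 ?add0r // => i _.
  by rewrite subn_eq0 leqNgt ltn_ord mul0r.
elim: m => [|m IHm]; first by rewrite hsum0 bin0.
rewrite hsum_head IHm IHs -mulrnDr; congr (_ *+ _).
by rewrite [size (b :: s)]/= addSn !addnS binS addnC.
Qed.
End CompleteHomogeneous.
Arguments hsum : simpl never.

Section Walks.
Variables (R : realFieldType) (I : finType) (beta : I -> I -> R).
Hypothesis beta_sym : forall a b, beta a b = beta b a.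
Hypothesis beta_ge0 : forall a b, 0 <= beta a b.

(* [(a, Some b)] stands for the entry [X_ab] and [(a, None)] for the row sum
   [\sum_b X_ab]. *)
Definition letter : Type := (I * option I)%type.
HB.instance Definition _ := Finite.on letter.

(** The expectation of the plain product, without conjugation: X_ab X_cd has mean [beta a b] if (c,
    d) = (b, a) and 0 otherwise. Summing over a second index lifts the condition on it. *)
Definition cov (x y : letter) : R :=
  beta x.1 y.1 * ((x.2 == None) || (x.2 == Some y.1))%:R
               * ((y.2 == None) || (y.2 == Some x.1))%:R.

Lemma cov_sym x y : cov x y = cov y x.
Proof. by rewrite /cov mulrAC beta_sym. Qed.

Lemma cov_ge0 x y : 0 <= cov x y.
Proof. by rewrite /cov !mulr_ge0. Qed.

Lemma cov_row a y : \sum_b cov (a, Some b) y = cov (a, None) y.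
Proof.
rewrite /cov /= -mulr_suml -mulr_sumr; congr (_ * _ * _).
rewrite (bigD1 y.1) //= eqxx big1 ?addr0 // => b; rewrite (inj_eq (@Some_inj _)).
by move/negbTE->.
Qed.

Lemma wick_row a M :
  \sum_b wick cov ((a, Some b) :: M) = wick cov ((a, None) :: M).
Proof.
rewrite wick_cons; under eq_bigr do rewrite wick_cons.
rewrite exchange_big /=; apply: eq_bigr => y _.
by rewrite -mulr_suml cov_row.
Qed.

Variable r : I.

(* [vwalks l A a M] sums [wick cov (w ++ M)] over the walks [w] of length [l] from
   [a] to [r] whose set of vertices other than [r] is [A]; [walks] does not
   constrain the vertices. *)
Fixpoint walks (l : nat) (a : I) (M : seq letter) : R :=
  if l is l'.+1 then \sum_b walks l' b ((a, Some b) :: M)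
  else (a == r)%:R * wick cov M.

Fixpoint vwalks (l : nat) (A : {set I}) (a : I) (M : seq letter) : R :=
  if l is l'.+1 then
    if a == r then \sum_b vwalks l' A b ((a, Some b) :: M)
    else (a \in A)%:R * (\sum_b vwalks l' A b ((a, Some b) :: M) +
                         \sum_b vwalks l' (A :\ a) b ((a, Some b) :: M))
  else ((a == r) && (A == set0))%:R * wick cov M.

Implicit Types (A : {set I}) (M : seq letter).

Lemma vwalks_out l A a M : a \notin r |: A -> vwalks l A a M = 0.
Proof.
by rewrite !inE; case: l => [|l] /=; case: eqP => //= _ /negbTE; rewrite ?mul0r // => ->; rewrite mul0r.
Qed.

(** Each vertex of [A] costs at least one step, its last exit. *)
Lemma vwalks_card l A a M : r \notin A -> (l < #|A|)%N -> vwalks l A a M = 0.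
Proof.
elim: l A a M => [|l IH] A a M rA lA /=.
  by case: eqP => [_|]; rewrite ?mul0r //= -cards_eq0 -leqn0 leqNgt lA mul0r.
have lA' : (l < #|A|)%N by exact: ltnW.
case: eqP => [_|_]; first by rewrite big1 // => b _; exact: IH.
have [aA|_] := boolP (a \in A); last by rewrite mul0r.
rewrite mul1r !big1 ?addr0 // => b _; rewrite IH // ?inE ?(negbTE rA) ?andbF //.
by rewrite (cardsD1 a) aA ltnS in lA.
Qed.

(** Walks are sorted by their vertex set. After a step out of [a != r], the rest of the walk has
    vertex set [A] or [A :\ a], according to whether it returns to [a]. *)
Lemma walks_vwalks l a M : walks l a M = \sum_(A : {set I} | r \notin A) vwalks l A a M.
Proof.
elim: l a M => [|l IH] a M /=.
  rewrite (bigD1 set0) ?inE //= eqxx andbT big1 ?addr0 // => A /andP[_ /negbTE ->].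
  by rewrite andbF mul0r.
under eq_bigr do rewrite IH.
rewrite exchange_big /=; case: eqP => [//|/eqP ar].
pose G A := \sum_b vwalks l A b ((a, Some b) :: M).
rewrite (bigID (fun A : {set I} => a \in A)) /= [RHS](bigID (fun A : {set I} => a \in A)) /=.
rewrite [X in _ = _ + X]big1 ?addr0; last by move=> A /andP[_ /negbTE ->]; rewrite mul0r.
under [RHS]eq_bigr => A /andP[_ ->] do rewrite mul1r.
rewrite big_split /=; congr (_ + _).
rewrite (reindex_onto (fun A => A :\ a) (fun A => a |: A)) /=; last first.
  by move=> A /andP[_ aA]; rewrite setU1K.
apply: eq_bigl => A; rewrite !inE eqxx /= andbT negb_and (eq_sym r a) negbK (negbTE ar) /=.
have [aA|aA] := boolP (a \in A); first by rewrite setD1K // eqxx !andbT.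
rewrite andbF; apply/negbTE; rewrite negb_and; apply/orP; right.
by apply: contra aA => /eqP <-; rewrite setU11.
Qed.
End Walks.

Lemma rem_map_inj (U V : eqType) (g : U -> V) x (l : seq U) : injective g ->
  rem (g x) (map g l) = map g (rem x l).
Proof. by move=> gi; elim: l => //= y l IH; rewrite inj_eq //; case: eqP => //= _; rewrite IH. Qed.

Lemma wick_map (A : comPzRingType) (U V : eqType) (g : U -> V) c c' l :
  injective g -> (forall x y, c (g x) (g y) = c' x y) ->
  wick c (map g l) = wick c' l :> A.
Proof.
move=> gi cc'; have [k] := ubnP (size l); elim: k l => // k IH [|x l] //= lk.
rewrite !wick_cons big_map big_seq [RHS]big_seq; apply: eq_bigr => y yl.
by rewrite rem_map_inj // cc' IH // size_rem // (leq_ltn_trans (leq_pred _)).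
Qed.

Lemma ler_sum_subpred (R : numDomainType) (T : finType) (P Q : pred T) (F : T -> R) :
  (forall t, P t -> Q t) -> (forall t, Q t -> 0 <= F t) ->
  \sum_(t | P t) F t <= \sum_(t | Q t) F t.
Proof.
move=> PQ F0; rewrite big_mkcond [leRHS]big_mkcond; apply: ler_sum => t _.
by case: ifP => [/PQ -> //|_]; case: ifP => // /F0.
Qed.

Section Relabel.
Variables (R : realFieldType) (I I' : finType) (f : I' -> I) (beta : I -> I -> R).
Hypothesis f_inj : injective f.
Let beta' a b := beta (f a) (f b).
Let fl (x : letter I') : letter I := (f x.1, omap f x.2).

(** Moves walks on a j-element set to the fixed vertex type [option 'I_j], with the root at [None],
    so that trees are indexed independently of the set. *)
Lemma vwalks_relabel r l (A : {set I'}) a M :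
  vwalks beta (f r) l (f @: A) (f a) (map fl M) = vwalks beta' r l A a M.
Proof.
have fl_inj : injective fl.
  by move=> [x [y|]] [x' [y'|]] //= [/f_inj -> //] /f_inj ->.
have covE x y : cov beta (fl x) (fl y) = cov beta' x y.
  case: x y => [x ox] [y oy]; rewrite /cov /=; congr (_ * (_ || _)%:R * (_ || _)%:R).
  - by case: ox.
  - by case: ox => //= z; rewrite !(inj_eq (@Some_inj _)) inj_eq.
  - by case: oy.
  - by case: oy => //= z; rewrite !(inj_eq (@Some_inj _)) inj_eq.
elim: l A a M => [|l IH] A a M /=.
  by rewrite inj_eq // imset_eq0 (wick_map _ fl_inj covE).
have S (B : {set I'}) : \sum_b vwalks beta (f r) l (f @: B) b ((f a, Some b) :: map fl M) =
    \sum_b vwalks beta' r l B b ((a, Some b) :: M).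
  rewrite (bigID (mem (f @: setT))) /= [X in _ + X]big1 ?addr0; last first.
    move=> b bT; apply: vwalks_out; apply: contra bT; rewrite !inE => /orP[/eqP ->|].
      by rewrite imset_f.
    by apply/subsetP/imsetS/subsetT.
  rewrite big_imset /=; last by move=> ? ? _ _; exact: f_inj.
  by apply: eq_big => [b|b _]; rewrite ?inE // -IH.
rewrite inj_eq // mem_imset // S; case: eqP => // _; congr (_ * (_ + _)).
suff -> : f @: A :\ f a = f @: (A :\ a) by rewrite S.
apply/setP => x; rewrite !inE; apply/andP/imsetP => [[xa /imsetP[y yA xy]]|[y + ->]].
  exists y => //; rewrite !inE yA andbT; apply: contra xa => /eqP <-.
  by rewrite xy.
by rewrite !inE inj_eq // => /andP[-> yA]; rewrite mem_imset.
Qed.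
End Relabel.

(** * Walks encoded by a last-exit tree and a multiset of row sums *)

Section Trees.
Variables (R : realFieldType) (I : finType) (beta : I -> I -> R).
Hypothesis beta_sym : forall a b, beta a b = beta b a.
Hypothesis beta_ge0 : forall a b, 0 <= beta a b.
Variable r : I.
Implicit Types (A : {set I}) (M : seq (letter I)) (T : {ffun I -> I}).

(* [T a] is the endpoint of the last step leaving [a]; outside [A] it takes the
   junk value [r]. *)
Definition is_tree A T :=
  [/\ forall a, a \notin A -> T a = r, forall a, a \in A -> T a \in r |: A &
      exists rho : I -> nat, forall a, a \in A -> (rho (T a) < rho a)%N].

Definition edges A T : seq (letter I) := [seq (k, Some (T k)) | k <- enum A].

Definition rows (y : seq I) : seq (letter I) := [seq (a, None) | a <- y].

Let F A T M y := wick (cov beta) (edges A T ++ rows y ++ M).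
Let wickP := @wick_perm R _ (cov beta) (cov_sym beta_sym).
Let wick0 l : 0 <= wick (cov beta) l.
Proof. exact/wick_ge0/cov_ge0. Qed.

Let hF0 s m A T M : 0 <= hsum s m (F A T M).
Proof. by apply: hsum_ge0 => y; exact: wick0. Qed.

Let F_perm A T M : perm_inv (F A T M).
Proof.
move=> y y' yy'; apply: wickP; rewrite perm_cat2l perm_cat2r; exact: perm_map.
Qed.

Let F_letter A T M x y : F A T (x :: M) y = wick (cov beta) (x :: edges A T ++ rows y ++ M).
Proof. by apply: wickP; rewrite !catA -[_ ++ x :: M]cat_rcons perm_catC perm_sym -cat_cons perm_catC perm_cat2l -perm_rcons. Qed.

Let F_cons A T M a y : F A T M (a :: y) = \sum_b F A T ((a, Some b) :: M) y.
Proof.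
under eq_bigr do rewrite F_letter.
by rewrite wick_row; apply: wickP; rewrite /= perm_catC /= perm_cons perm_catC.
Qed.

Let upd T a b : {ffun I -> I} := [ffun x => if x == a then b else T x].

Let is_tree_upd A T a b : a \in A -> a != r -> b \in r |: A :\ a -> is_tree (A :\ a) T ->
  is_tree A (upd T a b).
Proof.
move=> aA ar bA [Tr TA [rho Trho]]; split.
- move=> x xA; rewrite ffunE; case: eqP => [xa|_]; first by rewrite xa aA in xA.
  by rewrite Tr // !inE (negbTE xA) andbF.
- move=> x xA; rewrite ffunE; case: eqP => [_|/eqP xa].
    by move: bA; rewrite !inE => /orP[->//|/andP[_ ->]]; rewrite orbT.
  have := TA x; rewrite !inE xa xA => /(_ isT) /orP[->//|/andP[_ ->]]; by rewrite orbT.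
(* The new vertex [a] is a leaf, since [T] only takes values in [r |: A :\ a]; a rank just above
   that of its parent [b] is enough. *)
- exists (fun x => if x == a then (rho b).+1 else rho x) => x xA; rewrite ffunE.
  have ba : b != a by move: bA; rewrite !inE => /orP[/eqP ->|/andP[]//]; rewrite eq_sym.
  have [_|xa] := eqVneq x a; first by rewrite (negbTE ba) ltnSn.
  have xA' : x \in A :\ a by rewrite !inE xa.
  case: eqP => [Txa|_]; last exact: Trho.
  by have := TA x xA'; rewrite Txa !inE eqxx orbF (negbTE ar).
Qed.

Let edges_upd A T a b : a \in A ->
  perm_eq (edges A (upd T a b)) ((a, Some b) :: edges (A :\ a) T).
Proof.
move=> aA; have eA : perm_eq (enum A) (a :: enum (A :\ a)).
  apply: uniq_perm; rewrite ?enum_uniq //= ?enum_uniq ?andbT.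
    by rewrite mem_enum !inE eqxx.
  by move=> x; rewrite inE !mem_enum !inE; case: eqP => // ->.
rewrite (perm_trans (perm_map _ eA)) //= ffunE eqxx perm_cons.
rewrite (_ : [seq _ | _ <- _] = edges (A :\ a) T) //.
apply/eq_in_map => x; rewrite mem_enum !inE ffunE => /andP[/negbTE -> //].
Qed.

(* A step out of [a] is either not the last one leaving [a], and is put in the
   multiset of row sums, or it is, and then [a] is not visited again. *)
Lemma vwalks_le_trees l A a M : r \notin A -> (#|A| <= l)%N ->
  vwalks beta r l A a M <=
  \sum_(T : {ffun I -> I} | `[< is_tree A T >])
     hsum (r :: enum A) (l - #|A|) (fun y => wick (cov beta) (edges A T ++ rows y ++ M)).
Proof.
elim: l A a M => [|l IH] A a M rA.
  rewrite leqn0 cards_eq0 => /eqP ->.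
  rewrite (bigD1 [ffun=> r]) /=; last first.
    apply/asboolP; split => [x _|x|]; rewrite ?ffunE ?inE //.
    by exists (fun=> 0%N) => x; rewrite inE.
  apply: ler_wpDr; first by apply: sumr_ge0 => T _; exact: hF0.
  rewrite hsum0 /edges enum_set0 /= eqxx andbT.
  by case: eqP => _; rewrite ?mul1r // mul0r.
pose m := (l - #|A|)%N.
(* A non-last exit: summing over its endpoint adds [c] to the row sums, by [F_cons]. *)
have step c : (#|A| <= l)%N -> \sum_b vwalks beta r l A b ((c, Some b) :: M) <=
   \sum_(T : {ffun I -> I} | `[< is_tree A T >])
     hsum (r :: enum A) (l - #|A|) (fun y => F A T M (c :: y)).
  move=> lA; apply: (@le_trans _ _ (\sum_b \sum_(T : {ffun I -> I} | `[< is_tree A T >])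
     hsum (r :: enum A) (l - #|A|) (F A T ((c, Some b) :: M)))).
    by apply: ler_sum => b _; exact: IH.
  rewrite exchange_big /=; apply: ler_sum => T _; rewrite hsum_sum.
  by apply: hsum_le => y _; rewrite F_cons.
have step0 c : (l < #|A|)%N -> \sum_b vwalks beta r l A b ((c, Some b) :: M) = 0.
  by move=> lA; rewrite big1 // => b _; exact: vwalks_card.
have le1 T c : (#|A| <= l)%N -> c \in r :: enum A ->
    hsum (r :: enum A) m (fun y => F A T M (c :: y)) +
    hsum (rem c (r :: enum A)) m.+1 (F A T M) =
    hsum (r :: enum A) m.+1 (F A T M).
  by move=> lA cA; rewrite [RHS](hsum_rem _ _ cA).
move=> lA1 /=; case: eqP => [ar|/eqP ar].
  have [lA|lA] := leqP #|A| l; last by rewrite step0 //; apply: sumr_ge0 => T _; exact: hF0.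
  apply: (le_trans (step _ lA)); apply: ler_sum => T _.
  have ar' : a \in r :: enum A by rewrite ar mem_head.
  rewrite subSn // -/m -/(F A T M) -(le1 T a lA ar') lerDl; exact: hF0.
have [aA|_] := boolP (a \in A); last by rewrite mul0r; apply: sumr_ge0 => T _; exact: hF0.
rewrite mul1r.
have cA : #|A| = #|A :\ a|.+1 by rewrite (cardsD1 a) aA.
have remE : rem a (r :: enum A) = r :: enum (A :\ a).
  rewrite /= eq_sym (negbTE ar) rem_filter ?enum_uniq // /enum_mem -filter_predI.
  by congr (_ :: _); apply: eq_filter => x /=; rewrite !inE.
have lA' : (#|A :\ a| <= l)%N by rewrite -ltnS -cA.
pose G T := hsum (r :: enum (A :\ a)) (l - #|A :\ a|) (F A T M).
have step2 : \sum_b vwalks beta r l (A :\ a) b ((a, Some b) :: M) <=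
    \sum_(T : {ffun I -> I} | `[< is_tree A T >]) G T.
  rewrite [leRHS](partition_big (fun T : {ffun I -> I} => T a) xpredT) //=.
  apply: ler_sum => b _.
  have [bA|bA] := boolP (b \in r |: A :\ a); last first.
    by rewrite vwalks_out // sumr_ge0 // => T _; exact: hF0.
  apply: (le_trans (IH _ _ _ _ lA')); first by rewrite !inE negb_and rA orbT.
  (* Trees on [A :\ a] take the junk value [r] at [a], so resetting that value inverts the grafting
     of the edge from [a] to [b]. *)
  rewrite [leRHS](reindex_onto (fun T => upd T a b) (fun T => upd T a r)) /=; last first.
    move=> T /andP[_ /eqP Tb]; apply/ffunP => x; rewrite !ffunE.
    by case: eqP => // ->.
  rewrite (eq_bigr (fun T => G (upd T a b))); last first.
    move=> T _; apply: eq_hsum => y _; rewrite -/(F _ _ _ _) F_letter; apply: wickP.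
    by rewrite -cat_cons perm_cat2r perm_sym edges_upd.
  apply: ler_sum_subpred => [T /asboolP tT|T _]; last exact: hF0.
  rewrite ffunE !eqxx andbT; apply/andP; split.
    by apply/asboolP; exact: is_tree_upd.
  apply/eqP/ffunP => x; rewrite !ffunE; case: eqP => // ->.
  by case: tT => -> //; rewrite !inE eqxx.
(* If [l < #|A|] then [l.+1 = #|A|]: every step is a last exit and both multisets are empty. *)
have [lA|lA] := leqP #|A| l.
  apply: (le_trans (lerD (step _ lA) step2)); rewrite -big_split /=.
  apply: ler_sum => T _; rewrite subSn // -(le1 T a) // ?inE ?mem_enum ?aA ?orbT //.
  by rewrite remE /G (_ : l - #|A :\ a| = m.+1)%N // /m cA subnSK // -cA.
rewrite step0 // add0r (le_trans step2) // le_eqVlt; apply/orP; left; apply/eqP.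
have e : l.+1 = #|A| by apply/eqP; rewrite eqn_leq lA lA1.
by apply: eq_bigr => T _; rewrite /G e subnn (_ : l - _ = 0)%N ?hsum0 //; apply/eqP; rewrite subn_eq0 -ltnS -cA e.
Qed.
End Trees.

(* Number of ways to pick distinct positions of [y] carrying the letters [ts]. *)
Fixpoint ninj (I : eqType) (ts y : seq I) : nat :=
  if ts is t :: ts' then (count_mem t y * ninj ts' (rem t y))%N else 1%N.

Lemma sum_count_mem (I : finType) (y : seq I) : (\sum_a count_mem a y = size y)%N.
Proof.
elim: y => [|x y IH] /=; first by rewrite big1.
rewrite big_split /= IH (bigD1 x) //= eqxx big1 // => a.
by rewrite eq_sym => /negbTE ->.
Qed.

Lemma big_tuple_cons (R : Type) (idx : R) (op : Monoid.com_law idx) (I : finType) j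
    (F : seq I -> R) :
  \big[op/idx]_(t : j.+1.-tuple I) F t =
  \big[op/idx]_a \big[op/idx]_(t : j.-tuple I) F (a :: t).
Proof.
rewrite pair_big /= (reindex (fun p : I * j.-tuple I => [tuple of p.1 :: p.2])) //=.
exists (fun t : j.+1.-tuple I => (thead t, [tuple of behead t])).
  by move=> [a t] _; congr (_, _); apply: val_inj.
by move=> t _; rewrite [t in RHS]tuple_eta; apply: val_inj.
Qed.

(** Both sides count the injections of j places into the positions of [y]; an injection determines
    the letters [t] that it reads. *)
Lemma sum_ninj (I : finType) j (y : seq I) :
  (\sum_(t : j.-tuple I) ninj t y = size y ^_ j)%N.
Proof.
elim: j y => [|j IH] y.
  rewrite (eq_bigr (fun=> 1%N)) => [|t _]; last by rewrite tuple0.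
  by rewrite sum_nat_const card_tuple muln1 expn0 ffactn0.
rewrite (big_tuple_cons _ _ (fun t => ninj t y)) /=.
rewrite (eq_bigr (fun a => count_mem a y * (size y).-1 ^_ j)%N) => [|a _].
  by rewrite -big_distrl /= sum_count_mem ffactnS.
rewrite -big_distrr /= IH; have [ay|/count_memPn ->] := boolP (a \in y); last by rewrite !mul0n.
by rewrite size_rem.
Qed.

(** Moments of N_R(0, q), through the recursion given by integration by parts, which is also that of
    the pairings of m points with weight q per pair. *)
Fixpoint gmoment (R : pzSemiRingType) (q : R) (m : nat) : R :=
  match m with 0%N => 1 | 1%N => 0 | m'.+2 => (m'.+1)%:R * q * gmoment q m' end.

(** At [m = 0] the factor [m%:R] makes the truncated predecessor harmless. *)
Lemma gmomentSS (R : pzSemiRingType) (q : R) m :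
  gmoment q m.+1 = m%:R * q * gmoment q m.-1.
Proof. by case: m => [|m] //=; rewrite !mul0r. Qed.

Lemma gmoment_ge0 (R : numDomainType) (q : R) m : 0 <= q -> 0 <= gmoment q m.
Proof.
move=> q0; have [k] := ubnP m; elim: k m => // k IH [|[|m]] //= mk.
by rewrite !mulr_ge0 // IH // (leq_ltn_trans _ (ltnSE mk)).
Qed.

Arguments gmoment : simpl never.

(** * Wick sums of tree edges and row sums *)

Section WickBound.
Variables (R : realFieldType) (I : finType) (beta : I -> I -> R) (q : R).
Hypothesis beta_sym : forall a b, beta a b = beta b a.
Hypothesis beta_ge0 : forall a b, 0 <= beta a b.
Hypothesis beta_le : forall a b, beta a b <= q.
Variable r : I.
Implicit Types (A : {set I}) (T : {ffun I -> I}) (y : seq I).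

Let wickP := @wick_perm R _ (cov beta) (cov_sym beta_sym).

(** Any two row sums, equal or not, have covariance at most [q], as if they were all one Gaussian of
    variance [q]. *)
Lemma wick_rows_le y : wick (cov beta) (rows y) <= gmoment q (size y).
Proof.
have [k] := ubnP (size y); elim: k y => // k IH [|a y] /= yk; first by rewrite wick_nil.
rewrite wick_cons big_map gmomentSS.
have -> : (size y)%:R * q * gmoment q (size y).-1 = \sum_(b <- y) q * gmoment q (size y).-1.
  by rewrite big_const_seq count_predT iter_addr_0 -mulrA mulr_natl.
rewrite big_seq [leRHS]big_seq; apply: ler_sum => b yb.
rewrite /cov /= !mulr1 rem_map_inj => [|? ? [] //].
have sb : size (rem b y) = (size y).-1 by rewrite size_rem.
apply: ler_pM => //; first exact/wick_ge0/cov_ge0.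
by rewrite -sb; apply: IH; rewrite sb (leq_ltn_trans (leq_pred _)).
Qed.

(* [rho] excludes pairings between tree edges: [k -> T k] only correlates with
   the reversed edge, which would be a cycle. *)
Lemma wick_edges_le A T (ks : seq I) y : r \notin A -> is_tree r A T ->
  (forall k, k \in ks -> k \in A) ->
  wick (cov beta) ([seq (k, Some (T k)) | k <- ks] ++ rows y) <=
  (\prod_(k <- ks) beta k (T k)) * (ninj [seq T k | k <- ks] y)%:R *
  gmoment q (size y - size ks).
Proof.
move=> rA [_ _ [rho Trho]]; elim: ks y => [|k ks IH] y ksA.
  by rewrite big_nil !mul1r subn0 wick_rows_le.
have kA : k \in A by rewrite ksA ?mem_head.
have {}ksA k' : k' \in ks -> k' \in A by move=> k'ks; rewrite ksA // inE k'ks orbT.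
rewrite /= wick_cons big_cat /= big_map big_map.
rewrite big_seq big1 ?add0r => [|k' /ksA k'A]; last first.
  rewrite /cov /= !(inj_eq (@Some_inj _)).
  case: eqP => [Tk|_]; last by rewrite mulr0 !mul0r.
  case: eqP => [Tk'|_]; last by rewrite mulr0 mul0r.
  have := Trho _ kA; rewrite Tk => lt1; have := Trho _ k'A.
  by rewrite Tk' ltnNge (ltnW lt1).
pose K := wick (cov beta) ([seq (k, Some (T k)) | k <- ks] ++ rows (rem (T k) y)).
(* Among the row sums, the edge ending at [T k] is correlated with that of [T k] only, and all its
   copies contribute the same amount. *)
have -> : \sum_(a <- y) cov beta (k, Some (T k)) (a, None) *
      wick (cov beta) (rem (a, None) ([seq (k, Some (T k)) | k <- ks] ++ rows y)) =
    (count_mem (T k) y)%:R * (beta k (T k) * K).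
  rewrite -sum1_count natr_sum mulr_suml [RHS]big_mkcond /= big_seq [RHS]big_seq.
  apply: eq_bigr => a; rewrite /cov /= (inj_eq (@Some_inj _)) mulr1 eq_sym.
  case: eqP => [-> yT|_ _]; last by rewrite mulr0 mul0r.
  rewrite mulr1 mul1r; congr (_ * _); apply: wickP.
  rewrite -(perm_cons (T k, None)).
  set x : letter I := (T k, None); set l := map _ ks.
  have xl : x \in l ++ rows y by rewrite mem_cat map_f ?orbT.
  rewrite perm_sym; apply: perm_trans (perm_to_rem xl).
  rewrite -cat1s perm_catCA perm_cat2l perm_sym.
  exact: (perm_map (fun a => (a, None)) (perm_to_rem yT)).
have [yT|/count_memPn ->] := boolP (T k \in y); last by rewrite !(mul0r, mul0n, mulr0n, mulr0).
have -> : (size y - size (k :: ks) = size (rem (T k) y) - size ks)%N.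
  by rewrite size_rem //= subnS -subn1 subnAC subn1.
apply: (le_trans (ler_wpM2l _ (ler_wpM2l (beta_ge0 k (T k)) (IH _ ksA)))) => //.
by rewrite big_cons natrM -!mulrA le_eqVlt; apply/orP; left; apply/eqP; ring.
Qed.
End WickBound.

(* Resampling one coordinate of a uniform random function preserves its law. *)
Lemma sum_resample (R : nmodType) (K J : finType) (k0 : K) (F : {ffun K -> J} -> R) :
  \sum_(f : {ffun K -> J}) \sum_x F [ffun k => if k == k0 then x else f k] = (\sum_f F f) *+ #|J|.
Proof.
(* Exchanging the value [f k0] with the extra coordinate is an involution. *)
rewrite pair_big /= (reindex (fun p : {ffun K -> J} * J =>
   ([ffun k => if k == k0 then p.2 else p.1 k], p.1 k0))) /=; last first.
  exists (fun p : {ffun K -> J} * J => ([ffun k => if k == k0 then p.2 else p.1 k], p.1 k0)).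
    move=> [f x] _ /=; rewrite ffunE eqxx; congr (_, _).
    by apply/ffunP => k; rewrite !ffunE; case: eqP => // ->.
  move=> [f x] _ /=; rewrite ffunE eqxx; congr (_, _).
  by apply/ffunP => k; rewrite !ffunE; case: eqP => // ->.
rewrite -(pair_big xpredT xpredT (fun (f : {ffun K -> J}) (x : J) => F [ffun k => if k == k0 then f k0 else [ffun k => if k == k0 then x else f k] k])) /=.
rewrite -sumrMnl; apply: eq_bigr => f _; rewrite (eq_bigr (fun=> F f)) ?sumr_const // => x _.
by congr F; apply/ffunP => k; rewrite !ffunE; case: eqP => // ->.
Qed.

Section TreeSum.
Variables (R : realFieldType) (K J : finType) (B : J -> J -> R) (V : R) (r : J).
Hypothesis B_ge0 : forall a b, 0 <= B a b.
Hypothesis B_le : forall b, \sum_a B a b <= V.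
Variables (T : K -> option K) (rho : K -> nat).
Hypothesis rhoT : forall k k', T k = Some k' -> (rho k' < rho k)%N.

(* Leaves, i.e. vertices of maximal [rho], are summed first; the powers of [#|J|]
   account for the free coordinates of [f]. *)
Lemma tree_sum_sub (D : {set K}) :
  #|J|%:R ^+ #|D| * (\sum_(f : {ffun K -> J}) \prod_(k in D) B (f k) (oapp f r (T k)))
  <= #|J|%:R ^+ #|K| * V ^+ #|D|.
Proof.
have V0 : 0 <= V by apply: le_trans (B_le r); rewrite sumr_ge0.
move En : #|D| => m; elim: m D En => [|m IH] D En.
  move/eqP: En; rewrite cards_eq0 => /eqP ->; rewrite !expr0 mul1r mulr1.
  rewrite (eq_bigr (fun=> 1)) => [|f _]; last by rewrite big_set0.
  by rewrite sumr_const card_ffun natrX.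
have [k1 k1D] : exists k, k \in D by apply/set0Pn; rewrite -card_gt0 En.
pose k0 := [arg max_(k > k1 in D) rho k].
have [k0D k0max] : k0 \in D /\ forall k, k \in D -> (rho k <= rho k0)%N.
  by rewrite /k0; case: arg_maxnP.
pose P (f : {ffun K -> J}) := \prod_(k in D :\ k0) B (f k) (oapp f r (T k)).
have Tk k : k \in D -> T k <> Some k0.
  by move=> kD /rhoT; rewrite ltnNge k0max.
have PE (f : {ffun K -> J}) x : \prod_(k in D) B ([ffun k => if k == k0 then x else f k] k)
      (oapp [ffun k => if k == k0 then x else f k] r (T k)) =
    P f * B x (oapp f r (T k0)).
  rewrite (big_setD1 k0) //= mulrC ffunE eqxx; congr (_ * B _ _).
    apply: eq_bigr => k; rewrite !inE ffunE => /andP[/negbTE -> kD].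
    by case E : (T k) => [k'|] //=; rewrite ffunE; case: eqP => // k'k0; case: (Tk _ kD); rewrite E k'k0.
  case E : (T k0) => [k'|] //=; rewrite ffunE; case: eqP => // k'k0.
  by case: (Tk _ k0D); rewrite E k'k0.
rewrite exprSr -mulrA mulr_natl -(sum_resample k0).
have -> : \sum_(f : {ffun K -> J}) \sum_x \prod_(k in D) B ([ffun k => if k == k0 then x else f k] k)
      (oapp [ffun k => if k == k0 then x else f k] r (T k)) =
    \sum_(f : {ffun K -> J}) P f * \sum_x B x (oapp f r (T k0)).
  by apply: eq_bigr => f _; rewrite mulr_sumr; apply: eq_bigr => x _; exact: PE.
have Dm : #|D :\ k0| = m by move: En; rewrite (cardsD1 k0) k0D => -[].
apply: (@le_trans _ _ (#|J|%:R ^+ m * ((\sum_f P f) * V))).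
  rewrite ler_wpM2l ?exprn_ge0 // mulr_suml; apply: ler_sum => f _.
  by rewrite ler_wpM2l // prodr_ge0.
by rewrite mulrA exprSr mulrA ler_wpM2r // IH.
Qed.

Lemma tree_sum :
  \sum_(f : {ffun K -> J}) \prod_k B (f k) (oapp f r (T k)) <= V ^+ #|K|.
Proof.
have J0 : (0 < #|J|)%N by apply/card_gt0P; exists r.
have := tree_sum_sub setT; rewrite cardsT ler_pM2l ?exprn_gt0 ?ltr0n // => le1.
by apply: le_trans le1; rewrite le_eqVlt; apply/orP; left; apply/eqP; apply: eq_bigr => f _; apply: eq_bigl => k; rewrite inE.
Qed.
End TreeSum.

(** * Summation over vertex sets, trees and labellings *)

Section WalkBound.
Variables (R : realFieldType) (J : finType) (B : J -> J -> R) (q V : R).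
Hypothesis B_sym : forall a b, B a b = B b a.
Hypothesis B_ge0 : forall a b, 0 <= B a b.
Hypothesis B_le : forall a b, B a b <= q.
Hypothesis B_row : forall b, \sum_a B a b <= V.
Variable r : J.

Let q0 : 0 <= q. Proof. by apply: le_trans (B_le r r). Qed.

Section FixedLength.
Variables (L j : nat).
Hypothesis jL : (j <= L)%N.

Let A : {set option 'I_j} := [set~ None].
Let lab (f : {ffun 'I_j -> J}) : option 'I_j -> J := oapp f r.
(** A tree is given by the tuple of its parents, the form in which [sum_ninj] counts; the root gets
    the junk value [None] of [is_tree]. *)
Let tree (t : j.-tuple (option 'I_j)) : {ffun option 'I_j -> option 'I_j} :=
  [ffun a => if a is Some k then tnth t k else None].
(** What is left besides the tree weight: the multiset of exits, the row sums paired with the edges,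
    and the pairings of the other [L - 2 j] row sums. *)
Let shapes (t : seq (option 'I_j)) : R :=
  hsum (None :: enum A) (L - j) (fun y => (ninj t y)%:R) * gmoment q (L - j - j).
Let weight (f : {ffun 'I_j -> J}) (t : j.-tuple (option 'I_j)) := \prod_(k < j) B (f k) (lab f (tnth t k)).

Let cardA : #|A| = j.
Proof. by rewrite /A cardsC1 card_option card_ord. Qed.

Let shapes_ge0 t : 0 <= shapes t.
Proof. by rewrite mulr_ge0 ?gmoment_ge0 // hsum_ge0. Qed.

Let weight_ge0 f t : 0 <= weight f t.
Proof. exact: prodr_ge0. Qed.

Let sum_shapes : \sum_(t : j.-tuple (option 'I_j)) shapes t =
  ('C(L, j) * (L - j) ^_ j)%:R * gmoment q (L - j - j).
Proof.
rewrite -mulr_suml; congr (_ * _).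
rewrite hsum_sum (@eq_hsum _ _ _ _ _ (fun=> ((L - j) ^_ j)%:R)) => [|y sy]; last first.
  by rewrite -natr_sum sum_ninj sy.
by rewrite hsum_cst -cardE cardA subnK // bin_sub // natrM mulr_natl.
Qed.

Lemma vwalks_le_shapes (f : {ffun 'I_j -> J}) :
  vwalks (fun a b => B (lab f a) (lab f b)) None L A None [::] <=
  \sum_(t : j.-tuple (option 'I_j) | `[< is_tree None A (tree t) >]) weight f t * shapes t.
Proof.
set beta := fun a b => _.
have beta_sym a b : beta a b = beta b a by exact: B_sym.
have beta_ge0 a b : 0 <= beta a b by exact: B_ge0.
have nA : None \notin A by rewrite !inE.
apply: (le_trans (vwalks_le_trees beta_sym beta_ge0 _ _ nA _)); first by rewrite cardA.
rewrite (reindex tree) /=; last first.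
  exists (fun T : {ffun option 'I_j -> option 'I_j} => [tuple T (Some k) | k < j]).
    by move=> t _; apply: eq_from_tnth => k; rewrite tnth_mktuple ffunE.
  move=> T /asboolP[TN _ _]; apply/ffunP => -[k|]; rewrite ffunE ?tnth_mktuple //.
  by rewrite TN.
rewrite cardA; apply: ler_sum => t /asboolP tt.
rewrite /shapes mulrA mulrAC -hsumZ; apply: hsum_le => y sy.
have eA : perm_eq (enum A) [seq Some k | k <- enum 'I_j].
  apply: uniq_perm; first exact: enum_uniq.
    by rewrite map_inj_uniq ?enum_uniq // => ? ? [].
  move=> [k|]; rewrite mem_enum !inE; first by rewrite (mem_map (@Some_inj _)) mem_enum.
  by apply/esym/mapP => -[].
have := @wick_edges_le _ _ beta q beta_sym beta_ge0 _ None A (tree t) [seq Some k | k <- enum 'I_j] y nA tt.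
rewrite cats0 -(perm_big _ eA) => le1.
rewrite (wick_perm (cov_sym beta_sym) (l' := [seq (k, Some (tree t k)) | k <- [seq Some k | k <- enum 'I_j]] ++ rows y)); last first.
  by rewrite perm_cat2r; exact: perm_map.
apply: le_trans (le1 _ _) _ => //; first by move=> a b; exact: B_le.
  by move=> k /mapP[k' _ ->]; rewrite !inE.
rewrite size_map size_enum_ord sy (perm_big _ eA) /= big_map -map_comp.
rewrite (eq_map (g := tnth t)) => [|k]; last by rewrite /= ffunE.
rewrite map_tnth_enum mulrAC /weight big_enum /=.
by rewrite le_eqVlt; apply/orP; left; apply/eqP; congr (_ * _ * _); apply: eq_bigr => k _; rewrite ffunE.
Qed.

Let sum_weight t : is_tree None A (tree t) -> \sum_f weight f t <= V ^+ j.
Proof.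
case=> [_ _ [rho rhoT]]; rewrite -[in leRHS](card_ord j).
apply: (@tree_sum _ _ _ B V r B_ge0 B_row (tnth t) (rho \o Some)) => k k' tk /=.
by have := rhoT (Some k); rewrite !inE ffunE tk; apply.
Qed.

(** The factor [j!] counts the injective labellings [f] whose image is a given set [S]. *)
Lemma sum_vwalks_le :
  j`!%:R * \sum_(S : {set J} | (r \notin S) && (#|S| == j)) vwalks B r L S r [::] <=
  V ^+ j * (('C(L, j) * (L - j) ^_ j)%:R * gmoment q (L - j - j)).
Proof.
pose P (f : {ffun 'I_j -> J}) := injectiveb f && (r \notin f @: setT).
have vwalksf f : P f -> vwalks B r L (f @: setT) r [::] = vwalks (fun a b => B (lab f a) (lab f b)) None L A None [::].
  move=> /andP[/injectiveP f_inj rf].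
  have lab_inj : injective (lab f).
    move=> [k|] [k'|] //=; first by move/f_inj ->.
      by move=> E; case/negP: rf; rewrite -E imset_f.
    by move=> E; case/negP: rf; rewrite E imset_f.
  rewrite -(vwalks_relabel B lab_inj); congr (vwalks _ _ _ _ _ _).
  apply/setP => x; apply/imsetP/imsetP => [[k _ ->]|[[k|] kA ->]].
  - by exists (Some k); rewrite ?inE.
  - by exists k.
  - by rewrite !inE in kA.
have -> : j`!%:R * \sum_(S : {set J} | (r \notin S) && (#|S| == j)) vwalks B r L S r [::] =
    \sum_(f | P f) vwalks B r L (f @: setT) r [::].
  rewrite (partition_big (fun f : {ffun 'I_j -> J} => f @: setT)
    (fun S : {set J} => (r \notin S) && (#|S| == j))) /=; last first.
    by move=> f /andP[/injectiveP f_inj ->]; rewrite card_imset // cardsT card_ord eqxx.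
  rewrite mulr_sumr; apply: eq_bigr => S /andP[rS /eqP cS].
  rewrite (eq_bigr (fun=> vwalks B r L S r [::])) => [|f /andP[_ /eqP ->] //].
  rewrite sumr_const mulr_natl; congr (_ *+ _).
  rewrite -[LHS]ffactnn -[X in X ^_ _]cS -[X in _ ^_ X](card_ord j) -card_inj_ffuns_on cardsE.
  apply: eq_card => f; change ((f \in ffun_on (mem S)) && injectiveb f =
    P f && (f @: setT == S)); rewrite /P -!andbA.
  apply/andP/and3P => [[fS fi]|[fi _ /eqP <-]]; last first.
    by split=> //; apply/ffun_onP => k; rewrite imset_f.
  have fS' : f @: setT = S.
    apply/eqP; rewrite eqEcard card_imset ?cardsT ?card_ord ?cS ?leqnn ?andbT; last exact/injectiveP.
    by apply/subsetP => _ /imsetP[k _ ->]; exact: (ffun_onP fS).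
  by rewrite fS' eqxx.
(* Admitting non-injective labellings only adds nonnegative terms, and makes the labels of a tree
   independent, as [tree_sum] needs. *)
apply: (@le_trans _ _ (\sum_(f : {ffun 'I_j -> J})
    \sum_(t : j.-tuple (option 'I_j) | `[< is_tree None A (tree t) >]) weight f t * shapes t)).
  apply: (@le_trans _ _ (\sum_(f | P f)
    \sum_(t : j.-tuple (option 'I_j) | `[< is_tree None A (tree t) >]) weight f t * shapes t)).
    by apply: ler_sum => f Pf; rewrite vwalksf // vwalks_le_shapes.
  by apply: ler_sum_subpred => // f _; apply: sumr_ge0 => t _; rewrite mulr_ge0.
rewrite exchange_big /= -sum_shapes mulr_sumr.
apply: (@le_trans _ _ (\sum_(t | `[< is_tree None A (tree t) >]) V ^+ j * shapes t)).
  by apply: ler_sum => t /asboolP tt; rewrite -mulr_suml ler_wpM2r // sum_weight.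
apply: ler_sum_subpred => // t _; rewrite mulr_ge0 // exprn_ge0 //.
by apply: le_trans (B_row r); rewrite sumr_ge0.
Qed.
End FixedLength.

Lemma walks_le L : walks B r L r [::] <= \sum_(j < L.+1)
  V ^+ j * (('C(L, j) * (L - j) ^_ j)%:R * gmoment q (L - j - j)) / j`!%:R.
Proof.
rewrite walks_vwalks (bigID (fun S : {set J} => #|S| < L.+1)%N) /= [X in _ + X]big1 ?addr0; last first.
  by move=> S /andP[rS]; rewrite -leqNgt => LS; exact: vwalks_card.
rewrite (partition_big (fun S : {set J} => inord #|S| : 'I_L.+1) xpredT) //=.
apply: ler_sum => j _; rewrite ler_pdivlMr ?ltr0n ?fact_gt0 // mulrC.
have jL : (j <= L)%N by rewrite -ltnS.
rewrite (eq_bigl (fun S : {set J} => (r \notin S) && (#|S| == j))); first exact: sum_vwalks_le.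
move=> S; rewrite -andbA; congr (_ && _); apply/andP/eqP => [[SL /eqP <-]|SE].
  by rewrite inordK.
by rewrite SE ltn_ord; split=> //; apply/eqP; rewrite inord_val.
Qed.
End WalkBound.

From mathcomp Require Import spectral sesquilinear complex.
From mathcomp Require Import all_classical all_reals all_analysis.
From mathcomp Require Import measurable_realfun ring lra.

Import numFieldNormedType.Exports.

Local Open Scope classical_set_scope.

(** * Generating function *)

Section Series.
Variable R : realType.
Implicit Types (x q V : R).

Lemma sum_exp_coeff_le x M : 0 <= x -> \sum_(k < M) x ^+ k / k`!%:R <= expR x.
Proof.
move=> x0; rewrite -(big_mkord xpredT (fun k => x ^+ k / k`!%:R)).
apply: (@nondecreasing_cvgn_le _ (series (exp_coeff x))).
  by apply: nondecreasing_series => k _ _; exact: exp_coeff_ge0.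
exact: is_cvg_series_exp_coeff.
Qed.

(** The bound 4^j on the central binomial coefficient. *)
Lemma fact_double_le j : ((j.*2)`! <= 4 ^ j * j`! ^ 2)%N.
Proof.
elim: j => // j IH; rewrite doubleS !factS expnS.
have -> : (4 * 4 ^ j * (j.+1 * j`!) ^ 2 = (j.+1.*2 * j.+1.*2) * (4 ^ j * j`! ^ 2))%N.
  by rewrite -!mul2n; ring.
by rewrite mulnA leq_mul // leq_mul // doubleS leqnSn.
Qed.

(** A partial sum of the Bessel series I_0(2x), compared term by term with the even part of exp(2x).
    This is where the 2 in front of [sigma] arises. *)
Lemma sum_bessel_le x M : 0 <= x ->
  \sum_(j < M) (x ^+ 2) ^+ j / (j`!%:R ^+ 2) <= expR (2 * x).
Proof.
move=> x0; have x20 : 0 <= 2 * x by rewrite mulr_ge0.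
apply: le_trans (sum_exp_coeff_le M.*2 x20).
rewrite -(big_mkord xpredT (fun j => (x ^+ 2) ^+ j / (j`!%:R ^+ 2))).
rewrite -(big_mkord xpredT (fun k => (2 * x) ^+ k / k`!%:R)).
elim: M => [|M IH]; first by rewrite !big_geq.
rewrite doubleS !big_nat_recr //= -addrA lerD //.
apply: ler_wpDr; first by rewrite divr_ge0 // exprn_ge0.
have le4 : (M.*2)`!%:R <= 4 ^+ M * M`!%:R ^+ 2 :> R.
  by rewrite -!natrX -natrM ler_nat fact_double_le.
have -> : (2 * x) ^+ M.*2 = 4 ^+ M * (x ^+ 2) ^+ M.
  by rewrite -mul2n exprM (_ : (2 * x) ^+ 2 = 4 * x ^+ 2) ?exprMn //; ring.
rewrite ler_pdivrMr ?exprn_gt0 ?ltr0n ?fact_gt0 //.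
rewrite mulrAC ler_pdivlMr ?ltr0n ?fact_gt0 // mulrAC [leRHS]mulrC.
by rewrite ler_wpM2l // !exprn_ge0.
Qed.

Lemma gmoment_even q f : gmoment q f.*2 = q ^+ f * (f.*2)`!%:R / (2 ^+ f * f`!%:R).
Proof.
elim: f => [|f IH]; first by rewrite /= !mulr1 divr1.
rewrite doubleS gmomentSS /= IH !factS !natrM !exprS.
have := ltr0Sn R f; rewrite -[f.*2.+2]doubleS -!mul2n !natrM; set c := f.+1%:R => c0.
have f0 : f`!%:R != 0 :> R by rewrite pnatr_eq0 -lt0n fact_gt0.
have p0 : 2 ^+ f != 0 :> R by rewrite expf_neq0 // pnatr_eq0.
by field; rewrite f0 p0 gt_eqF.
Qed.

(** Up to [(2p)!], the coefficient is a function of [j] times a function of [p - j], hence a term of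
    a Cauchy product. *)
Lemma walk_coeff (V q : R) p j : (j <= p)%N ->
  V ^+ j * (('C(p.*2, j) * (p.*2 - j) ^_ j)%:R * gmoment q (p.*2 - j - j)) / j`!%:R =
  (p.*2)`!%:R * ((V ^+ j / j`!%:R ^+ 2) * ((q / 2) ^+ (p - j) / (p - j)`!%:R)).
Proof.
move=> jp; have j2p : (j <= p.*2)%N by rewrite (leq_trans jp) // -addnn leq_addr.
have -> : (p.*2 - j - j = (p - j).*2)%N by rewrite -subnDA addnn doubleB.
rewrite gmoment_even.
have E : ('C(p.*2, j) * (p.*2 - j) ^_ j * (j`! * (p - j).*2`!) = p.*2`!)%N.
  have jp' : (j <= p.*2 - j)%N by rewrite leq_subRL // addnn leq_double.
  rewrite -(bin_fact j2p) -(ffact_fact jp') -subnDA addnn doubleB; ring.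
have {E} -> : p.*2`!%:R = ('C(p.*2, j) * (p.*2 - j) ^_ j)%:R * (j`!%:R * (p - j).*2`!%:R) :> R.
  by rewrite -E !natrM.
have f0 k : k`!%:R != 0 :> R by rewrite pnatr_eq0 -lt0n fact_gt0.
have p0 : 2 ^+ (p - j) != 0 :> R by rewrite expf_neq0 // pnatr_eq0.
by rewrite expr_div_n; field; rewrite !f0 p0.
Qed.

Lemma generating_le (a : nat -> R) (c : R) V q theta M :
  0 <= c -> 0 <= V -> 0 <= q -> 0 <= theta ->
  (forall p, a p <= c * \sum_(j < (p.*2).+1)
     V ^+ j * (('C(p.*2, j) * (p.*2 - j) ^_ j)%:R * gmoment q (p.*2 - j - j)) / j`!%:R) ->
  \sum_(p < M) theta ^+ p.*2 / (p.*2)`!%:R * a p <=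
  c * expR (2 * (theta * Num.sqrt V) + theta ^+ 2 * q / 2).
Proof.
move=> c0 V0 q0 t0 ale.
pose u j := (theta ^+ 2 * V) ^+ j / j`!%:R ^+ 2.
pose v f := (theta ^+ 2 * q / 2) ^+ f / f`!%:R.
have f0 k : k`!%:R != 0 :> R by rewrite pnatr_eq0 -lt0n fact_gt0.
have u0 j : 0 <= u j by rewrite divr_ge0 ?exprn_ge0 ?mulr_ge0 ?exprn_ge0.
have v0 j : 0 <= v j by rewrite divr_ge0 ?exprn_ge0 ?mulr_ge0 ?exprn_ge0 ?invr_ge0.
have le1 p : theta ^+ p.*2 / (p.*2)`!%:R * a p <= c * \sum_(j < p.+1) u j * v (p - j)%N.
  apply: (@le_trans _ _ (theta ^+ p.*2 / (p.*2)`!%:R * (c * \sum_(j < (p.*2).+1)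
     V ^+ j * (('C(p.*2, j) * (p.*2 - j) ^_ j)%:R * gmoment q (p.*2 - j - j)) / j`!%:R))).
    by rewrite ler_wpM2l // divr_ge0 // exprn_ge0.
  rewrite mulrCA ler_wpM2l // mulr_sumr.
  rewrite -(big_mkord xpredT (fun j => theta ^+ p.*2 / (p.*2)`!%:R * (V ^+ j * (('C(p.*2, j) * (p.*2 - j) ^_ j)%:R * gmoment q (p.*2 - j - j)) / j`!%:R))).
  (* Terms with [j > p] vanish: there are fewer row sums than tree edges, and the falling factorial
     is 0. *)
  rewrite (big_cat_nat (n := p.+1)) //=; last by rewrite ltnS -addnn leq_addr.
  rewrite [X in _ + X]big_nat [X in _ + X]big1 ?addr0 => [|j /andP[pj jp]]; last first.
    rewrite ffact_small ?muln0 ?mul0r ?mulr0 ?mul0r ?mulr0 //.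
    by rewrite ltn_subLR // addnn ltn_double.
  rewrite big_mkord; apply: ler_sum => -[j /= jp] _.
  rewrite ltnS in jp; rewrite walk_coeff // [leLHS]mulrA divfK //.
  have -> : theta ^+ p.*2 = (theta ^+ 2) ^+ j * (theta ^+ 2) ^+ (p - j).
    by rewrite -exprD subnKC // -exprM mul2n.
  by rewrite mulrACA /u /v -[theta ^+ 2 * q / 2]mulrA !exprMn !mulrA.
apply: (@le_trans _ _ (\sum_(p < M) c * \sum_(j < p.+1) u j * v (p - j)%N)).
  by apply: ler_sum => p _; exact: le1.
rewrite -mulr_sumr ler_wpM2l // expRD.
have sV : (theta * Num.sqrt V) ^+ 2 = theta ^+ 2 * V by rewrite exprMn sqr_sqrtr.
have s0 : 0 <= theta * Num.sqrt V by rewrite mulr_ge0 // sqrtr_ge0.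
(* The triangle [j + f < M] is enlarged to the square [j, f < M]. *)
apply: (@le_trans _ _ ((\sum_(j < M) u j) * (\sum_(f < M) v f))); last first.
  apply: ler_pM; rewrite ?sumr_ge0 //.
    by have := sum_bessel_le M s0; rewrite sV.
  by apply: sum_exp_coeff_le; rewrite mulr_ge0 ?mulr_ge0 ?exprn_ge0 ?invr_ge0.
rewrite mulr_suml; under [leRHS]eq_bigr do rewrite mulr_sumr.
rewrite (eq_bigr (fun p : 'I_M => \sum_(j < M | (j <= p)%N) u j * v (p - j)%N)) => [|p _]; last first.
  rewrite (big_ord_widen_cond M xpredT (fun j => u j * v (p - j)%N)) //.
rewrite (exchange_big_dep xpredT) //=; apply: ler_sum => j _.
rewrite -(big_mkord (fun p => j <= p)%N (fun p => u j * v (p - j)%N)).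
rewrite -(big_mkord xpredT (fun f => u j * v f)).
rewrite (big_cat_nat (n := j)) //=; last exact: ltnW.
rewrite big_nat_cond big1 ?add0r => [|p /andP[/andP[_ pj]]]; last by rewrite leqNgt pj.
rewrite -{1}[val j]add0n big_addn.
rewrite [leRHS](big_cat_nat (n := (M - j)%N)) //=; last exact: leq_subr.
rewrite big_mkcond /= ler_wpDr //; first by apply: sumr_ge0 => p _; rewrite mulr_ge0.
by apply: ler_sum => p _; rewrite leq_addl addnK.
Qed.
End Series.

(** * Spectral norm and traces *)

Section SpectralNorm.
Local Open Scope sesquilinear_scope.
Variables (R : realType) (n : nat) (A : 'M[R[i]]_n).
Hypothesis A_herm : forall i j, A i j = Num.conj (A j i).

Let rc := @real_complex R.

(** Both facts come from one diagonalization, which ties the supremum defining the norm to the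
    traces. *)
Lemma hermitian_spectrum : exists lam : 'I_n -> R,
  (forall k, \tr (A ^+ k) = rc (\sum_i lam i ^+ k)) /\
  singular_values A = [set s | 0 <= s /\ exists i, s = `|lam i|].
Proof.
have hA : A \is hermsymmx.
  by apply/is_hermitianmxP; rewrite expr0 scale1r; apply/matrixP => i j; rewrite !mxE -A_herm.
have /hermitian_normalmx /orthomx_spectralP AE := hA.
have /mxOverP spR := hermitian_spectral_diag_real hA.
set P := spectralmx A in AE; set sp := spectral_diag A in AE spR.
have Pu : P \in unitmx by exact: spectral_unit.
pose lam i := complex.Re (sp 0 i).
have spE i : sp 0 i = rc (lam i) by rewrite /rc RRe_real.
pose D k := diag_mx (\row_i rc (lam i) ^+ k).
have Ak k : A ^+ k = invmx P *m D k *m P.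
  elim: k => [|k IH].
    have -> : D 0%N = 1%:M.
      by apply/matrixP => i j; rewrite !mxE; case: eqP.
    by rewrite expr0 mulmx1 mulVmx.
  rewrite exprS IH -[A * _]/(A *m _) [X in X *m _]AE !mulmxA mulmxK //.
  rewrite -[invmx P *m _ *m D k]mulmxA mulmx_diag; congr (_ *m diag_mx _ *m _).
  by apply/rowP => i; rewrite !mxE spE exprS.
exists lam; split=> [k|].
  rewrite Ak mxtrace_mulC mulmxA mulmxV // mul1mx mxtrace_diag.
  by rewrite /rc rmorph_sum; apply: eq_bigr => i _; rewrite mxE rmorphXn.
have AA : A ^t* *m A = A ^+ 2.
  by rewrite expr2; congr (_ *m _); apply/matrixP => i j; rewrite !mxE -A_herm.
have eqlam s i : 0 <= s -> rc (s ^+ 2) = rc (lam i) ^+ 2 -> s = `|lam i|.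
  move=> s0; rewrite -rmorphXn => /complexI /(congr1 Num.sqrt).
  by rewrite !sqrtr_sqr ger0_norm.
apply/seteqP; split => [s [s0]|s [s0 [i si]]].
  rewrite AA Ak => /eigenvalueP[v vA v0]; split=> //.
  pose w := v *m invmx P.
  have wD : w *m D 2%N = rc (s ^+ 2) *: w.
    have := congr1 (mulmx^~ (invmx P)) vA.
    by rewrite !mulmxA mulmxK // -scalemxAl.
  have /rV0Pn[i wi] : w != 0.
    by apply: contra v0 => /eqP w0; rewrite -(mulmxKV Pu v) -/w w0 mul0mx.
  exists i; apply: eqlam => //; apply: (mulIf wi).
  have /rowP/(_ i) := wD; rewrite mul_mx_diag !mxE => <-.
  by rewrite mulrC.
(* Eigenvectors are row vectors here; this one is row [i] of the diagonalizing matrix. *)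
split=> //; rewrite AA Ak; apply/eigenvalueP; exists (delta_mx 0 i *m P).
  rewrite !mulmxA mulmxK // scalemxAl; congr (_ *m _).
  apply/rowP => j; rewrite mul_mx_diag !mxE eqxx /= si.
  case: eqP => [->|_]; last by rewrite mul0r mulr0.
  by rewrite mul1r mulr1 -rmorphXn /= real_normK // num_real.
apply/negP => /eqP /(congr1 (mulmx^~ (invmx P))); rewrite mulmxK // mul0mx.
by move/rowP/(_ i)/eqP; rewrite !mxE !eqxx oner_eq0.
Qed.

Lemma spectral_norm_max : (0 < n)%N -> exists lam : 'I_n -> R,
  (forall k, \tr (A ^+ k) = rc (\sum_i lam i ^+ k)) /\
  exists2 j, spectral_norm A = `|lam j| & forall i, `|lam i| <= `|lam j|.
Proof.
move=> n0; have [lam [trE svE]] := hermitian_spectrum.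
exists lam; split=> //.
pose j := [arg max_(i > Ordinal n0) `|lam i|]%O.
have jmax i : `|lam i| <= `|lam j| by rewrite /j; case: arg_maxP => // k _; apply.
exists j => //; rewrite /spectral_norm svE; apply/eqP; rewrite eq_le; apply/andP; split.
  apply: ge_sup; first by exists `|lam j|; split=> //; exists j.
  by move=> _ [_ [i ->]].
apply: ub_le_sup; last by split=> //; exists j.
by exists `|lam j| => _ [_ [i ->]].
Qed.

Lemma spectral_norm_ge0 : (0 < n)%N -> 0 <= spectral_norm A.
Proof. by move=> /spectral_norm_max[lam [_ [j ->]]]. Qed.

Lemma trace_even_bounds p : (0 < n)%N ->
  spectral_norm A ^+ p.*2 <= complex.Re (\tr (A ^+ p.*2)) <= n%:R * spectral_norm A ^+ p.*2.
Proof.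
move=> /spectral_norm_max[lam [trE [j -> jmax]]].
have ev (x : R) : x ^+ p.*2 = `|x| ^+ p.*2.
  by rewrite -mul2n !exprM real_normK // num_real.
rewrite trE /=; apply/andP; split.
  rewrite -ev (bigD1 j) //= lerDl; apply: sumr_ge0 => i _.
  by rewrite ev exprn_ge0.
apply: (@le_trans _ _ (\sum_(i < n) `|lam j| ^+ p.*2)).
  by apply: ler_sum => i _; rewrite ev lerXn2r ?nnegrE.
by rewrite sumr_const card_ord mulr_natl.
Qed.

(* The traces of the even powers detect the spectral norm, since they lie
   between [spectral_norm A ^ 2p] and [n * spectral_norm A ^ 2p]. *)
Lemma lt_spectral_norm a : 0 <= a -> (0 < n)%N ->
  (a < spectral_norm A) <-> exists k : nat,
    forall p, (a + k.+1%:R^-1) ^+ p.*2 <= complex.Re (\tr (A ^+ p.*2)).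
Proof.
move=> a0 n0; split=> [aA|[k kA]].
  have [k ak] := ltr_add_invr aA.
  exists k => p; have /andP[+ _] := trace_even_bounds p n0; apply: le_trans.
  by rewrite lerXn2r ?nnegrE ?addr_ge0 ?spectral_norm_ge0 // ltW.
rewrite ltNge; apply/negP => Aa.
(* If the norm is at most [a], then [c^(2p) <= n a^(2p)] for all [p], whereas [(a/c)^(2p)] tends to
   0: the gap between [a] and [c] absorbs the factor [n]. *)
set c := a + _ in kA; have c0 : 0 < c by rewrite ltr_wpDl // invr_gt0.
have ac : `|a / c| < 1.
  by rewrite ger0_norm ?divr_ge0 ?(ltW c0) // ltr_pdivrMr // mul1r ltrDl invr_gt0.
have n1 : 0 < (n%:R : R)^-1 by rewrite invr_gt0 ltr0n.
have [N _ /(_ N.*2)] := cvgr0_norm_lt _ (cvg_expr ac) _ n1.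
rewrite /= -addnn leq_addr => /(_ isT); apply/negP; rewrite -leNgt addnn.
rewrite ger0_norm ?exprn_ge0 ?divr_ge0 ?(ltW c0) //.
rewrite expr_div_n ler_pdivlMr ?exprn_gt0 // ler_pdivrMl ?ltr0n //.
apply: (le_trans (kA N)); have /andP[_ le2] := trace_even_bounds N n0.
apply: (le_trans le2); rewrite ler_wpM2l // lerXn2r ?nnegrE ?spectral_norm_ge0 //.
Qed.
End SpectralNorm.

(** There are no nonzero vectors, so the supremum is that of the empty set, 0 by default. *)
Lemma spectral_norm_dim0 (R : realType) (A : 'M[R[i]]_0) : spectral_norm A = 0.
Proof.
rewrite /spectral_norm (_ : singular_values A = set0) ?sup0 //.
apply/seteqP; split=> // s [_ /eigenvalueP[v _]].
by rewrite (_ : v = 0) ?eqxx //; apply/rowP => -[].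
Qed.

(** * Gaussian moments *)

Section Transfer.
Local Open Scope ereal_scope.
Context (d' : measure_display) (Y : measurableType d') (R : realType).
Import HBNNSimple.

Lemma integral_density_approx (d : measure_display) (T : measurableType d) (mu : {measure set T -> \bar R})
    (Z : T -> Y) (G : T -> R) (f : Y -> R) (mf : measurable_fun setT (fun y => (f y)%:E)) :
  measurable_fun setT Z -> measurable_fun setT G ->
  (forall x, (0 <= G x)%R) -> (forall y, (0 <= f y)%R) ->
  let f_ := nnsfun_approx measurableT mf in
  \int[mu]_x (G x * f (Z x))%:E = limn (fun n => \sum_(k \in range (f_ n))
     k%:E * \int[mu]_x (G x * \1_(f_ n @^-1` [set k]) (Z x))%:E).
Proof.
move=> mZ mG G0 f0 f_.
have mfn n : measurable_fun setT (f_ n \o Z).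
  by apply: measurableT_comp => //; exact: measurable_funP.
transitivity (\int[mu]_x limn (fun n => (G x * f_ n (Z x))%:E)).
  apply: eq_integral => x _; apply/esym/cvg_lim => //.
  under eq_fun do rewrite EFinM; rewrite EFinM; apply: cvgeZl => //.
  by have := @cvg_nnsfun_approx _ Y R _ measurableT _ mf (fun y _ => f0 y) (Z x) I.
rewrite monotone_convergence //; last 3 first.
- by move=> n; apply/measurable_EFinP/measurable_funM => //; exact: mfn.
- by move=> n x _; rewrite lee_fin mulr_ge0.
- move=> x _ m n mn; rewrite lee_fin ler_wpM2l //.
  by have /lefP := @nd_nnsfun_approx _ _ _ _ measurableT _ mf _ _ mn; exact.
congr (limn _); apply/funext => n.
have mfi k : measurable_fun setT (fun x => \1_(f_ n @^-1` [set k]) (Z x) : R).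
  have m1 : measurable_fun setT (\1_(f_ n @^-1` [set k]) : Y -> R).
    by apply: measurable_indic; exact: measurable_sfunP.
  exact: (measurableT_comp m1 mZ).
rewrite (eq_integral (fun x => \sum_(k \in range (f_ n)) k%:E * (G x * \1_(f_ n @^-1` [set k]) (Z x))%:E)); last first.
  move=> x _; rewrite (fimfunE (f_ n) (Z x)) mulr_fsumr -fsumEFin //.
  by apply: eq_fsbigr => k _; rewrite -EFinM mulrCA.
rewrite ge0_integral_fsum //; last 2 first.
- move=> k; apply/measurable_EFinP; apply: measurable_funM => //.
  exact: measurable_funM.
- move=> k x _; rewrite EFinM muleCA mule_ge0 ?lee_fin //.
  exact: nnfun_muleindic_ge0.
apply: eq_fsbigr => k /[!inE] -[y _ <-].
rewrite ge0_integralZl //.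
- by apply/measurable_EFinP/measurable_funM.
- by move=> x _; rewrite lee_fin mulr_ge0.
- by rewrite lee_fin.
Qed.

(** The weights serve two purposes: a weight is the normal density when a law is transferred, and
    the product of the other factors when independence is used. *)
Lemma integral_density_eq (d1 d2 : measure_display) (T1 : measurableType d1)
    (T2 : measurableType d2)
    (mu1 : {measure set T1 -> \bar R}) (mu2 : {measure set T2 -> \bar R})
    (Z1 : T1 -> Y) (Z2 : T2 -> Y) (G1 : T1 -> R) (G2 : T2 -> R) (f : Y -> R) :
  measurable_fun setT Z1 -> measurable_fun setT Z2 ->
  measurable_fun setT G1 -> measurable_fun setT G2 ->
  (forall x, (0 <= G1 x)%R) -> (forall x, (0 <= G2 x)%R) ->
  measurable_fun setT f -> (forall y, (0 <= f y)%R) ->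
  (forall A, measurable A -> \int[mu1]_x (G1 x * \1_A (Z1 x))%:E =
                             \int[mu2]_x (G2 x * \1_A (Z2 x))%:E) ->
  \int[mu1]_x (G1 x * f (Z1 x))%:E = \int[mu2]_x (G2 x * f (Z2 x))%:E.
Proof.
move=> mZ1 mZ2 mG1 mG2 G10 G20 mf f0 E.
have mf' : measurable_fun setT (fun y => (f y)%:E) by exact/measurable_EFinP.
rewrite (integral_density_approx mu1 mf' mZ1 mG1) //.
rewrite (integral_density_approx mu2 mf' mZ2 mG2) //.
congr (limn _); apply/funext => n; apply: eq_fsbigr => k _; congr (_ * _).
exact: E.
Qed.

Lemma integrable_density_eq (d1 d2 : measure_display) (T1 : measurableType d1)
    (T2 : measurableType d2)
    (mu1 : {measure set T1 -> \bar R}) (mu2 : {measure set T2 -> \bar R})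
    (Z1 : T1 -> Y) (Z2 : T2 -> Y) (G1 : T1 -> R) (G2 : T2 -> R) (f : Y -> R) :
  measurable_fun setT Z1 -> measurable_fun setT Z2 ->
  measurable_fun setT G1 -> measurable_fun setT G2 ->
  (forall x, (0 <= G1 x)%R) -> (forall x, (0 <= G2 x)%R) ->
  measurable_fun setT f ->
  (forall A, measurable A -> \int[mu1]_x (G1 x * \1_A (Z1 x))%:E =
                             \int[mu2]_x (G2 x * \1_A (Z2 x))%:E) ->
  mu2.-integrable setT (fun x => (G2 x * f (Z2 x))%:E) ->
  mu1.-integrable setT (fun x => (G1 x * f (Z1 x))%:E) /\
  \int[mu1]_x (G1 x * f (Z1 x))%:E = \int[mu2]_x (G2 x * f (Z2 x))%:E.
Proof.
move=> mZ1 mZ2 mG1 mG2 G10 G20 mf E if2.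
have mGf (d : measure_display) (T : measurableType d) (G : T -> R) (Z : T -> Y) (g : Y -> R) :
    measurable_fun setT G -> measurable_fun setT Z -> measurable_fun setT g ->
    measurable_fun setT (fun x => (G x * g (Z x))%:E).
  move=> mG mZ mg; apply/measurable_EFinP; apply: measurable_funM => //.
  exact: measurableT_comp.
have tr (g : Y -> R) : measurable_fun setT g -> (forall y, (0 <= g y)%R) ->
    \int[mu1]_x (G1 x * g (Z1 x))%:E = \int[mu2]_x (G2 x * g (Z2 x))%:E.
  by move=> mg g0; exact: integral_density_eq.
have if1 : mu1.-integrable setT (fun x => (G1 x * f (Z1 x))%:E).
  apply/integrableP; split; first exact: mGf.
  have /integrableP[_] := if2; apply: le_lt_trans.
  have nG (d : measure_display) (T : measurableType d) (mu : {measure set T -> \bar R})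
      (G : T -> R) (Z : T -> Y) : (forall x, (0 <= G x)%R) ->
      \int[mu]_x `|(G x * f (Z x))%:E| = \int[mu]_x (G x * `|f (Z x)|)%:E.
    by move=> G0; apply: eq_integral => x _; rewrite abse_EFin normrM (ger0_norm (G0 x)).
  rewrite !nG // (tr (fun y => `|f y|%R)) //.
  by apply: measurableT_comp => //; exact: normr_measurable.
split=> //.
pose fp y := Num.max (f y) 0%R; pose fn y := Num.max (- f y)%R 0%R.
have mfp : measurable_fun setT fp by exact: measurable_maxr.
have mfn : measurable_fun setT fn by apply: measurable_maxr => //; exact: measurableT_comp.
have fp0 y : (0 <= fp y)%R by rewrite le_max lexx orbT.
have fn0 y : (0 <= fn y)%R by rewrite le_max lexx orbT.
have fE y : f y = (fp y - fn y)%R by rewrite /fp /fn; case: (lerP (f y) 0); case: (lerP (- f y) 0); lra.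
have fple y : (fp y <= `|f y|)%R by rewrite /fp ge_max ler_norm normr_ge0.
have fnle y : (fn y <= `|f y|)%R by rewrite /fn ge_max -normrN ler_norm normr_ge0.
have ig (d : measure_display) (T : measurableType d) (mu : {measure set T -> \bar R})
    (G : T -> R) (Z : T -> Y) (g : Y -> R) :
    measurable_fun setT G -> measurable_fun setT Z -> measurable_fun setT g ->
    (forall x, (0 <= G x)%R) -> (forall y, (0 <= g y)%R) -> (forall y, (g y <= `|f y|)%R) ->
    mu.-integrable setT (fun x => (G x * f (Z x))%:E) ->
    mu.-integrable setT (fun x => (G x * g (Z x))%:E).
  move=> mG mZ mg G0 g0 gle; apply: le_integrable => //; first exact: mGf.
  by move=> x _; rewrite lee_fin !normrM ler_wpM2l // (ger0_norm (g0 _)).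
have split_int (d : measure_display) (T : measurableType d) (mu : {measure set T -> \bar R})
    (G : T -> R) (Z : T -> Y) :
    measurable_fun setT G -> measurable_fun setT Z -> (forall x, (0 <= G x)%R) ->
    mu.-integrable setT (fun x => (G x * f (Z x))%:E) ->
    \int[mu]_x (G x * f (Z x))%:E = \int[mu]_x (G x * fp (Z x))%:E - \int[mu]_x (G x * fn (Z x))%:E.
  move=> mG mZ G0 iG; rewrite -integralB //; try by apply: ig.
  by apply: eq_integral => x _; rewrite fE mulrBr EFinB.
by rewrite !split_int // (tr _ mfp fp0) (tr _ mfn fn0).
Qed.
End Transfer.

(** * Moments of the normal density *)

Section IntegralDerive.
Context (R : realType).
Notation mu := (@lebesgue_measure R).

(** The fundamental theorem of calculus on [[-n, n]], then dominated convergence with [h] itself as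
    the bound. *)
Lemma integral_derive_eq0 (H h : R -> R) :
  (forall x : R, is_derive x 1 H (h x)) -> continuous h ->
  mu.-integrable setT (EFin \o h) ->
  H n%:R @[n --> \oo] --> 0 -> H (- n%:R) @[n --> \oo] --> 0 ->
  (\int[mu]_x (h x)%:E = 0)%E.
Proof.
move=> dH ch ih Hn HNn.
pose D (n : nat) : set R := `[- n%:R, n%:R]%classic.
have mD n : measurable (D n) by exact: measurable_itv.
pose f_ n := (EFin \o h) \_ (D n).
have mh : measurable_fun setT (EFin \o h) by exact: measurable_int ih.
have fcvg x : f_ n x @[n --> \oo] --> (h x)%:E.
  apply: cvg_near_cst.
  near=> n; rewrite /f_ patchE ifT //; apply/mem_set; rewrite /D /= in_itv /= -ler_norml.
  by near: n; exact: nbhs_infty_ger.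
have fle x n : (`|f_ n x| <= `|(h x)%:E|)%E.
  by rewrite /f_ patchE; case: ifP => //; rewrite abse0.
have mfn n : measurable_fun setT (f_ n).
  exact/(measurable_restrictT _ (mD n))/measurable_funTS.
have ae1 : {ae mu, forall x, [set: R] x -> f_ n x @[n --> \oo] --> (EFin \o h) x}.
  by apply: aeW => x _; exact: fcvg.
have ae2 : {ae mu, forall x n, [set: R] x -> (`|f_ n x| <= (abse \o (EFin \o h)) x)%E}.
  by apply: aeW => x n _; exact: fle.
have [_ _] := @dominated_convergence _ _ _ mu _ measurableT f_ (EFin \o h) _ mfn mh ae1
  (integrable_abse ih) ae2.
have intD n : (\int[mu]_x f_ n.+1 x = (H n.+1%:R - H (- n.+1%:R))%:E)%E.
  rewrite -integral_mkcond EFinB; apply: continuous_FTC2.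
  - by apply: (@lt_trans _ _ 0); rewrite ?oppr_lt0 ltr0Sn.
  - by apply: continuous_subspaceT.
  - have cH : continuous H.
      by move=> x; apply/differentiable_continuous/derivable1_diffP; case: (dH x).
    split=> [x _||].
    + by case: (dH x).
    + exact: (cvg_at_right_filter (cH _)).
    + exact: (cvg_at_left_filter (cH _)).
  - by move=> x _; rewrite derive1E; case: (dH x) => _ ->.
rewrite -cvg_shiftS /=; under eq_fun do rewrite intD.
move=> c1; have c2 : (H n.+1%:R - H (- n.+1%:R))%:E @[n --> \oo] --> 0%:E.
  apply: cvg_EFin; first by near=> n.
  rewrite -[X in _ --> X](subr0 (0 : R)); apply: cvgB.
    by move: Hn; rewrite -(cvg_shiftS (fun n => H n%:R)).
  by move: HNn; rewrite -(cvg_shiftS (fun n => H (- n%:R))).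
exact: cvg_unique c1 c2.
Unshelve. all: by end_near. Qed.
End IntegralDerive.

Lemma centered_normal_pdfE (R : realType) (s x : R) : s != 0 ->
  normal_pdf 0 s x = normal_peak s * expR (- x ^+ 2 / (s ^+ 2 *+ 2)).
Proof. by move=> s0; rewrite normal_pdfE // /normal_fun subr0. Qed.

Section GaussianDensity.
Context (R : realType).
Notation mu := (@lebesgue_measure R).
Variable s : R.
Hypothesis s0 : s != 0.

Let w : R -> R := normal_pdf 0 s.

Let wE x : w x = normal_peak s * expR (- x ^+ 2 / (s ^+ 2 *+ 2)).
Proof. exact: centered_normal_pdfE. Qed.

Let q0 : 0 < s ^+ 2. Proof. by rewrite exprn_even_gt0. Qed.

Lemma is_derive_normal_pdf (x : R) : is_derive x 1 w (- (x / s ^+ 2) * w x).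
Proof.
pose u : R -> R := (- (s ^+ 2 *+ 2)^-1) \*: ((@id R) ^+ 2).
have du : is_derive x 1 u (- (x / s ^+ 2)).
  apply: (is_derive_eq (is_deriveZ _ (is_deriveX 2 (is_derive_id x 1)))).
  rewrite /GRing.scale /= -mulr_natr expr1.
  by field; rewrite s0.
have uE y : u y = - y ^+ 2 / (s ^+ 2 *+ 2).
  by rewrite /u /GRing.scale /= exprfctE [LHS]mulNr [RHS]mulNr mulrC.
have -> : w = normal_peak s \*: (expR \o u).
  by apply/funext => y; rewrite wE -uE.
have dv := is_derive1_comp (is_derive_expR (u x)) du.
apply: (is_derive_eq (is_deriveZ _ dv)); rewrite /GRing.scale /= -[normal_peak s *: _]/(normal_peak s * _); ring.
Qed.

(** Doubling the standard deviation absorbs any power; this gives both integrability and decay at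
    infinity. *)
Lemma pow_normal_pdf_le k : exists2 C, 0 <= C &
  forall x, `|x ^+ k * w x| <= C * normal_pdf 0 (2 * s) x.
Proof.
have s20 : 2 * s != 0 by rewrite mulf_neq0.
have p0 := normal_peak_gt0 s0; have p20 := normal_peak_gt0 s20.
(* With [y = x^2 / (4 s^2)], [|x^k| <= 1 + x^(2k)] and [y^k <= k! exp y]; the peaks convert one
   normalization into the other. *)
exists ((1 + (4 * s ^+ 2) ^+ k * k`!%:R) * normal_peak s / normal_peak (2 * s)).
  by rewrite !mulr_ge0 ?invr_ge0 ?(ltW p0) ?(ltW p20) // addr_ge0 // mulr_ge0 // exprn_ge0 // mulr_ge0 // ltW.
move=> x; rewrite centered_normal_pdfE // [leRHS]mulrA divfK ?gt_eqF //.
rewrite wE normrM [`|normal_peak s * _|]ger0_norm ?mulr_ge0 ?expR_ge0 ?(ltW p0) //.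
pose y := x ^+ 2 / (4 * s ^+ 2).
have y0 : 0 <= y by rewrite divr_ge0 ?exprn_even_ge0 // mulr_ge0 // ltW.
have xk : `|x ^+ k| <= (1 + (4 * s ^+ 2) ^+ k * k`!%:R) * expR y.
  apply: (@le_trans _ _ (1 + (4 * s ^+ 2) ^+ k * k`!%:R * (y ^+ k / k`!%:R))).
    have -> : (4 * s ^+ 2) ^+ k * k`!%:R * (y ^+ k / k`!%:R) = (x ^+ k) ^+ 2.
      rewrite mulrACA divff ?pnatr_eq0 -?lt0n ?fact_gt0 // mulr1 -exprMn /y.
      have c0 : 4 * s ^+ 2 != 0 by rewrite mulf_neq0 ?pnatr_eq0 // gt_eqF.
      by rewrite [4 * _ * _]mulrC divfK // -!exprM mulnC.
    rewrite -[X in _ <= 1 + X]real_normK ?num_real //.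
    have := normr_ge0 (x ^+ k); set z := `|_|; move=> z0.
    have := sqr_ge0 (z - 1); nra.
  rewrite [leRHS]mulrDl mul1r lerD //.
    by rewrite -[leLHS]expR0 ler_expR.
  apply: ler_wpM2l; first by rewrite mulr_ge0 // exprn_ge0 // mulr_ge0 // ltW.
  apply: (le_trans _ (sum_exp_coeff_le k.+1 y0)).
  by rewrite big_ord_recr /= lerDr sumr_ge0 // => i _; rewrite divr_ge0 // exprn_ge0.
apply: (le_trans (ler_wpM2r _ xk)); first by rewrite mulr_ge0 ?expR_ge0 ?(ltW p0).
rewrite -!mulrA ler_wpM2l //; first by rewrite addr_ge0 // mulr_ge0 // exprn_ge0 // mulr_ge0 // ltW.
rewrite mulrCA ler_wpM2l ?(ltW p0) // -expRD ler_expR.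
rewrite /y exprMn -(mulr_natr (s ^+ 2)) -(mulr_natr (2 ^+ 2 * _)).
have -> : x ^+ 2 / (4 * s ^+ 2) + - x ^+ 2 / (s ^+ 2 * 2) = - x ^+ 2 / (4 * s ^+ 2).
  by field; rewrite s0.
rewrite !mulNr lerN2 ler_wpM2l ?exprn_even_ge0 //.
by rewrite lef_pV2 ?posrE; have := q0; nra.
Qed.

Lemma integrable_pow_normal_pdf k : mu.-integrable setT (fun x => (x ^+ k * w x)%:E).
Proof.
have [C C0 Cle] := pow_normal_pdf_le k.
have ig : mu.-integrable setT (fun x => (C%:E * (normal_pdf 0 (2 * s) x)%:E)%E).
  by apply: integrableZl => //; exact: integrable_normal_pdf.
apply: (le_integrable measurableT _ _ ig).
  apply/measurable_EFinP; apply: measurable_funM; first exact: measurable_funX.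
  exact: measurable_normal_pdf.
by move=> x _; rewrite -EFinM lee_fin (le_trans (Cle x)) // ler_norm.
Qed.

Lemma cvg_pow_normal_pdf k (u : nat -> R) : (forall n, `|u n| = n%:R) ->
  u n ^+ k * w (u n) @[n --> \oo] --> 0.
Proof.
(* One power more than needed turns boundedness into decay of order 1/n. *)
move=> un; have [C C0 Cle] := pow_normal_pdf_le k.+1.
have [D D0 Dle] : exists2 D, 0 <= D & forall x, `|x ^+ k.+1 * w x| <= D.
  exists (C * normal_peak (2 * s)); first by rewrite mulr_ge0 // normal_peak_ge0.
  move=> x; apply: le_trans (Cle x) _; rewrite ler_wpM2l //.
  by apply: normal_pdf_ub; rewrite mulf_neq0.
rewrite -(cvg_shiftS (fun n => u n ^+ k * w (u n))); apply: norm_cvg0.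
have cD : D * harmonic n @[n --> \oo] --> 0.
  by rewrite -[X in _ --> X](mulr0 D); apply: cvgM; [exact: cvg_cst|exact: cvg_harmonic].
apply: (squeeze_cvgr _ (cvg_cst 0) cD); near=> n.
rewrite normr_ge0 /= ler_pdivlMr ?ltr0Sn // -[X in _ * X]un -normrM mulrAC -exprSr.
exact: Dle.
Unshelve. all: by end_near. Qed.

(** The derivative of [x^k w] is [k x^(k-1) w - x^(k+1) w / s^2], and its integral is 0. *)
Lemma moment_normal_pdf k : (\int[mu]_x (x ^+ k * w x)%:E)%E = (gmoment (s ^+ 2) k)%:E.
Proof.
have [m] := ubnP k; elim: m k => // m IH [|k] km.
  under eq_integral do rewrite mul1r.
  by rewrite integral_normal_pdf.
pose h x := k%:R * (x ^+ k.-1 * w x) - (s ^+ 2)^-1 * (x ^+ k.+1 * w x).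
have dH (x : R) : is_derive x 1 (fun x => x ^+ k * w x) (h x).
  have -> : (fun x => x ^+ k * w x) = ((@id R) ^+ k * w).
    by apply/funext => y; rewrite [RHS]/GRing.mul /= exprfctE.
  apply: (is_derive_eq (is_deriveM (is_deriveX k (is_derive_id x 1)) (is_derive_normal_pdf x))).
  by rewrite /h /GRing.scale /= exprfctE (exprS x k); ring.
have ih1 : mu.-integrable setT (fun x => (k%:R%:E * (x ^+ k.-1 * w x)%:E)%E).
  by apply: integrableZl => //; exact: integrable_pow_normal_pdf.
have ih2 : mu.-integrable setT (fun x => ((s ^+ 2)^-1%:E * (x ^+ k.+1 * w x)%:E)%E).
  by apply: integrableZl => //; exact: integrable_pow_normal_pdf.
have ih : mu.-integrable setT (EFin \o h).
  by apply: eq_integrable (integrableB measurableT ih1 ih2) => // x _; rewrite /h /= EFinB !EFinM.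
have ch : continuous h.
  have cw : continuous w by exact: continuous_normal_pdf.
  move=> x; apply: cvgB; apply: cvgM; try exact: cvg_cst; apply: cvgM => //; try exact: cw; exact: exprn_continuous.
have := integral_derive_eq0 dH ch ih.
have n1 n : `|n%:R : R| = n%:R by rewrite ger0_norm.
have n2 n : `|- n%:R : R| = n%:R by rewrite normrN.
move=> /(_ (cvg_pow_normal_pdf k n1) (cvg_pow_normal_pdf k n2)).
have -> : (fun x : R => (h x)%:E) = (fun x : R => k%:R%:E * (x ^+ k.-1 * w x)%:E -
    (s ^+ 2)^-1%:E * (x ^+ k.+1 * w x)%:E)%E.
  by apply/funext => x; rewrite /h EFinB !EFinM.
rewrite integralB //= !integralZl //; try exact: integrable_pow_normal_pdf.
rewrite IH ?(leq_ltn_trans (leq_pred _)) //.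
have : (\int[mu]_x (x ^+ k.+1 * w x)%:E)%E \is a fin_num.
  by apply: integrable_fin_num => //; exact: integrable_pow_normal_pdf.
move/fineK <-; set I := fine _; rewrite -!EFinM -EFinB => -[E].
rewrite gmomentSS; congr (_%:E); apply: (mulfI (x := (s ^+ 2)^-1)); first by rewrite invr_neq0 // gt_eqF.
move/eqP: E; rewrite subr_eq0 => /eqP <-.
by field; rewrite s0.
Qed.
End GaussianDensity.

Section GaussianLaw.
Context (d : measure_display) (T : measurableType d) (R : realType) (P : probability T R).
Variables (Z : T -> R) (s : R).
Hypothesis Z_law : has_law P Z (gaussR s).

Let mZ : measurable_fun setT Z. Proof. by case: Z_law. Qed.

Let law_indic A : measurable A ->
  (\int[P]_w (1 * \1_A (Z w))%:E = gaussR s A)%E.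
Proof.
move=> mA; case: Z_law => _ <- //.
under eq_integral do rewrite mul1r.
rewrite -(setIT (Z @^-1` A)) -integral_indic //.
by rewrite -(setTI (_ @^-1` _)); exact: mZ.
Qed.

Lemma gauss_moment k : P.-integrable setT (fun w => (Z w ^+ k)%:E) /\
  (\int[P]_w (Z w ^+ k)%:E = (gmoment (s ^+ 2) k)%:E)%E.
Proof.
have mX : measurable_fun setT (fun x : R => x ^+ k) by exact: measurable_funX.
have m1 : measurable_fun [set: T] (fun=> 1 : R) by exact: measurable_cst.
have -> : (fun w => (Z w ^+ k)%:E) = (fun w => (1 * Z w ^+ k)%:E).
  by apply/funext => w; rewrite mul1r.
have [s0|s0] := eqVneq s 0.
  have E A : measurable A -> (\int[P]_w (1 * \1_A (Z w))%:E =
      \int[\d_(0%R : R)]_x (1 * \1_A x)%:E)%E.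
    move=> mA; rewrite law_indic // /gaussR s0 eqxx.
    by under eq_integral do rewrite mul1r; rewrite integral_indic // setIT.
  have i2 : (\d_(0%R : R)).-integrable setT (fun x : R => (1 * x ^+ k)%:E).
    apply/integrableP; split.
      by apply/measurable_EFinP; apply: measurable_funM => //; exact: measurable_cst.
    rewrite integral_dirac //; first by rewrite diracT mul1e ltry.
    apply: measurableT_comp => //; apply/measurable_EFinP.
    by apply: measurable_funM => //; exact: measurable_cst.
  have [i1 ->] := integrable_density_eq (mu1 := P) (mu2 := \d_(0%R : R)) (Z1 := Z) (Z2 := id)
    (G1 := fun=> 1) (G2 := fun=> 1) mZ (@measurable_id _ _ _) m1 (measurable_cst _)
    (fun _ => ler01) (fun _ => ler01) mX E i2.
  split=> //; rewrite integral_dirac //.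
    rewrite diracT mul1e mul1r s0; congr (_%:E).
    by case: k {mX E i2 i1} => [|k]; rewrite ?expr0 // !expr0n gmomentSS /= mulr0 mul0r.
  by apply/measurable_EFinP; apply: measurable_funM => //; exact: measurable_cst.
have E A : measurable A -> (\int[P]_w (1 * \1_A (Z w))%:E =
    \int[@lebesgue_measure R]_x (normal_pdf 0 s x * \1_A x)%:E)%E.
  move=> mA; rewrite law_indic // /gaussR (negbTE s0) /normal_prob integral_mkcond.
  apply: eq_integral => x _; rewrite patchE indicE; case: ifP => _; rewrite ?mulr1 ?mulr0 //.
have iX := integrable_pow_normal_pdf s0 k.
have i2 : (@lebesgue_measure R).-integrable setT (fun x : R => (normal_pdf 0 s x * x ^+ k)%:E).
  by apply: eq_integrable iX => // x _; rewrite mulrC.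
have [i1 ->] := integrable_density_eq (mu1 := P) (mu2 := @lebesgue_measure R) (Z1 := Z) (Z2 := id)
  (G1 := fun=> 1) (G2 := normal_pdf 0 s) mZ (@measurable_id _ _ _) m1 (measurable_normal_pdf 0 s)
  (fun _ => ler01) (normal_pdf_ge0 0 s) mX E i2.
split=> //; rewrite -(moment_normal_pdf s0 k).
by apply: eq_integral => x _; rewrite mulrC.
Qed.
End GaussianLaw.

(** * Expectations of products of independent factors *)

Section IndependentProducts.
Context (d d' : measure_display) (T : measurableType d) (Y : measurableType d')
  (R : realType) (P : probability T R) (K : finType) (D : {set K}) (Z : K -> T -> Y).
Hypothesis mZ : forall k, k \in D -> measurable_fun setT (Z k).
Hypothesis Z_indep : forall A : K -> set Y, (forall k, measurable (A k)) ->
  P (\bigcap_(k in [set` D]) (Z k @^-1` A k)) = (\prod_(k in D) P (Z k @^-1` A k))%E.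

Let mfZ (f : Y -> R) k : k \in D -> measurable_fun setT f -> measurable_fun setT (fun w => f (Z k w)).
Proof. by move=> kD mf; apply: (measurableT_comp mf); exact: mZ. Qed.

Let mpre A k : k \in D -> measurable A -> measurable (Z k @^-1` A).
Proof. by move=> kD mA; rewrite -(setTI (_ @^-1` _)); exact: mZ. Qed.

Let int_indic A k : k \in D -> measurable A ->
  (\int[P]_w (\1_A (Z k w))%:E = (fine (P (Z k @^-1` A)))%:E)%E.
Proof.
move=> kD mA; rewrite fineK; last by apply: fin_num_measure; exact: mpre.
rewrite -(setIT (Z k @^-1` A)) -integral_indic //; exact: mpre.
Qed.

(** Indicators are turned into functions one index at a time. For a new index [i], the induction
    hypothesis with [A i] replaced by any [B] is the premise of [integral_density_eq], the other
    factors being the weight. *)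
Let ge0_mixed (f : K -> Y -> R) (m : K -> R) (s : seq K) (A : K -> set Y) :
  (forall k, measurable_fun setT (f k)) -> (forall k y, 0 <= f k y) ->
  (forall k, k \in D -> (\int[P]_w (f k (Z k w))%:E = (m k)%:E)%E) ->
  (forall k, measurable (A k)) ->
  (\int[P]_w (\prod_(k in D) (if k \in s then f k (Z k w) else \1_(A k) (Z k w)))%:E =
    (\prod_(k in D) (if k \in s then m k else fine (P (Z k @^-1` A k))))%:E)%E.
Proof.
move=> mf f0 fm; elim: s A => [|i s IH] A mA.
  have E w : \prod_(k in D) (if k \in [::] then f k (Z k w) else \1_(A k) (Z k w)) =
      \1_(\bigcap_(k in [set` D]) (Z k @^-1` A k)) w :> R.
    have [wA|wA] := pselect ((\bigcap_(k in [set` D]) (Z k @^-1` A k)) w).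
      rewrite indicE mem_set // big1 // => k kD; rewrite /= indicE mem_set //.
      exact: wA.
    rewrite indicE memNset //; have [k kD kA] : exists2 k, k \in D & ~ A k (Z k w).
      by apply: contrapT => H; apply: wA => k kD; apply: contrapT => kA; apply: H; exists k.
    by rewrite (bigD1 k) //= indicE memNset // mul0r.
  under eq_integral do rewrite E.
  rewrite integral_indic //; last first.
    by apply: fin_bigcap_measurable => // k kD; exact: mpre.
  rewrite setIT; apply: (etrans (Z_indep mA)); rewrite -prodEFin; apply: eq_bigr => k kD.
  by rewrite /= fineK //; apply: fin_num_measure; exact: mpre.
have [iD|iD] := boolP (i \in D); last first.
  have ne k : k \in D -> (k \in i :: s) = (k \in s).
    by move=> kD; rewrite inE; case: eqP => // ki; rewrite -ki kD in iD.
  have := IH A mA; rewrite (eq_bigr (fun k => if k \in i :: s then m k else fine (P (Z k @^-1` A k)))).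
    move=> <-; apply: eq_integral => w _; congr (_%:E); apply: eq_bigr => k kD; rewrite ne //.
  by move=> k kD; rewrite ne.
have [is_|is_] := boolP (i \in s).
  have ne k : (k \in i :: s) = (k \in s) by rewrite inE; case: eqP => // ->.
  have := IH A mA; rewrite (eq_bigr (fun k => if k \in i :: s then m k else fine (P (Z k @^-1` A k)))).
    move=> <-; apply: eq_integral => w _; congr (_%:E); apply: eq_bigr => k kD; rewrite ne //.
  by move=> k kD; rewrite ne.
have m0 k : k \in D -> 0 <= m k.
  by move=> kD; rewrite -lee_fin -fm //; apply: integral_ge0 => w _; rewrite lee_fin.
pose h k w := if k \in s then f k (Z k w) else \1_(A k) (Z k w).
pose mm k := if k \in s then m k else fine (P (Z k @^-1` A k)).
pose G w := \prod_(k in D | k != i) h k w.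
pose c := \prod_(k in D | k != i) mm k.
have h0 k w : 0 <= h k w by rewrite /h; case: ifP => // _; rewrite indicE.
have G0 w : 0 <= G w by exact: prodr_ge0.
have c0 : 0 <= c.
  apply: prodr_ge0 => k /andP[kD _]; rewrite /mm; case: ifP => _; first exact: m0.
  by rewrite fine_ge0.
have mh k : k \in D -> measurable_fun setT (h k).
  move=> kD; rewrite /h; case: (k \in s); first exact: mfZ.
  by apply: (mfZ kD); exact: measurable_indic.
have mG : measurable_fun setT G.
  rewrite /G; under eq_fun do rewrite -big_filter.
  apply: measurable_prod => k; rewrite mem_filter => /andP[/andP[kD _] _]; exact: mh.
have E B : measurable B -> (\int[P]_w (G w * \1_B (Z i w))%:E =
    \int[P]_w (c * \1_B (Z i w))%:E)%E.
  move=> mB; pose A' k := if k == i then B else A k.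
  have mA' k : measurable (A' k) by rewrite /A'; case: ifP.
  have := IH A' mA'.
  rewrite (eq_integral (fun w => (G w * \1_B (Z i w))%:E)); last first.
    move=> w _; rewrite (bigD1 i) //= (negbTE is_) /A' eqxx mulrC; congr (_ * _)%:E.
    by apply: eq_bigr => k /andP[_ /negbTE ->].
  move=> ->; rewrite (bigD1 i) //= (negbTE is_) /A' eqxx mulrC.
  under eq_integral do rewrite EFinM.
  rewrite ge0_integralZl ?lee_fin //; last first.
    by apply/measurable_EFinP; apply: (mfZ iD); exact: measurable_indic.
  rewrite int_indic // -EFinM; congr ((_ * _)%:E).
  by apply: eq_bigr => k /andP[_ /negbTE ->].
rewrite (eq_integral (fun w => (G w * f i (Z i w))%:E)); last first.
  move=> w _; rewrite (bigD1 i) //= mem_head mulrC; congr (_ * _)%:E.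
  by apply: eq_bigr => k /andP[_ /negbTE ki]; rewrite inE ki.
rewrite (integral_density_eq (mu2 := P) (Z2 := Z i) (G2 := fun=> c) _ _ mG _ G0 _ (mf i) (f0 i) E) //; try exact: mZ.
under eq_integral do rewrite EFinM.
rewrite ge0_integralZl ?lee_fin //; last 2 first.
- by apply/measurable_EFinP; exact: mfZ.
- by move=> w _; rewrite lee_fin.
rewrite fm // -EFinM (bigD1 i) //= mem_head mulrC; congr ((_ * _)%:E).
by apply: eq_bigr => k /andP[_ /negbTE ki]; rewrite inE ki.
Qed.

Lemma ge0_expectation_prod (f : K -> Y -> R) (m : K -> R) :
  (forall k, measurable_fun setT (f k)) -> (forall k y, 0 <= f k y) ->
  (forall k, k \in D -> (\int[P]_w (f k (Z k w))%:E = (m k)%:E)%E) ->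
  (\int[P]_w (\prod_(k in D) f k (Z k w))%:E = (\prod_(k in D) m k)%:E)%E.
Proof.
move=> mf f0 fm; have := ge0_mixed (enum K) (A := fun=> set0) mf f0 fm (fun _ => measurable0).
under eq_integral do under eq_bigr do rewrite mem_enum.
by under [in RHS]eq_bigr do rewrite mem_enum.
Qed.

Let integrable_prod (f : K -> Y -> R) :
  (forall k, measurable_fun setT (f k)) ->
  (forall k, k \in D -> P.-integrable setT (fun w => (f k (Z k w))%:E)) ->
  P.-integrable setT (fun w => (\prod_(k in D) f k (Z k w))%:E).
Proof.
move=> mf fi; apply/integrableP; split.
  apply/measurable_EFinP; under eq_fun do rewrite -big_filter.
  by apply: measurable_prod => k; rewrite mem_filter => /andP[kD _]; exact: mfZ.
have nf k : k \in D -> (\int[P]_w `|f k (Z k w)|%:E =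
    (fine (\int[P]_w `|f k (Z k w)|%:E))%:E)%E.
  move=> kD; rewrite fineK //; apply: integrable_fin_num => //.
  exact: integrable_norm (fi k kD).
have := ge0_expectation_prod (f := fun k y => `|f k y|) _ _ nf.
under eq_integral do rewrite -normr_prod.
move=> ->; rewrite ?ltry // => k.
by apply: measurableT_comp => //; exact: normr_measurable.
Qed.

(** [s] lists the indices where the factor may change sign; each is split into its positive and
    negative parts in turn. *)
Let signed_mixed (s : seq K) (f : K -> Y -> R) (m : K -> R) :
  (forall k, measurable_fun setT (f k)) ->
  (forall k, k \in D -> P.-integrable setT (fun w => (f k (Z k w))%:E)) ->
  (forall k, k \in D -> (\int[P]_w (f k (Z k w))%:E = (m k)%:E)%E) ->
  (forall k, k \notin s -> forall y, 0 <= f k y) ->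
  (\int[P]_w (\prod_(k in D) f k (Z k w))%:E = (\prod_(k in D) m k)%:E)%E.
Proof.
elim: s f m => [|i s IH] f m mf fi fm f0.
  by apply: ge0_expectation_prod => // k; exact: f0.
pose fp y := Num.max (f i y) 0; pose fn y := Num.max (- f i y) 0.
have mfp : measurable_fun setT fp by exact: measurable_maxr.
have mfn : measurable_fun setT fn by apply: measurable_maxr => //; exact: measurableT_comp.
have fp0 y : 0 <= fp y by rewrite le_max lexx orbT.
have fn0 y : 0 <= fn y by rewrite le_max lexx orbT.
have fE y : f i y = fp y - fn y by rewrite /fp /fn; case: (lerP (f i y) 0); case: (lerP (- f i y) 0); lra.
have fple y : fp y <= `|f i y| by rewrite /fp ge_max ler_norm normr_ge0.
have fnle y : fn y <= `|f i y| by rewrite /fn ge_max -normrN ler_norm normr_ge0.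
pose upd g k := if k == i then g else f k : Y -> R.
have mupd g k : measurable_fun setT g -> measurable_fun setT (upd g k).
  by rewrite /upd; case: ifP.
have iupd (g : Y -> R) k : measurable_fun setT g -> (forall y, 0 <= g y) ->
    (forall y, g y <= `|f i y|) -> k \in D -> P.-integrable setT (fun w => (upd g k (Z k w))%:E).
  move=> mg g0 gle kD; rewrite /upd; case: eqP => [ki|_]; last exact: fi.
  apply: (le_integrable measurableT _ _ (fi k kD)).
    by apply/measurable_EFinP; exact: mfZ.
  by move=> w _; rewrite ki lee_fin (ger0_norm (g0 _)).
pose mupd_ (g : Y -> R) k := if k == i then fine (\int[P]_w (g (Z i w))%:E)%E else m k.
have IHg (g : Y -> R) : measurable_fun setT g -> (forall y, 0 <= g y) -> (forall y, g y <= `|f i y|) ->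
    (\int[P]_w (\prod_(k in D) upd g k (Z k w))%:E = (\prod_(k in D) mupd_ g k)%:E)%E.
  move=> mg g0 gle; apply: IH => [k|k kD|k kD|k ks y].
  - exact: mupd.
  - exact: iupd.
  - have := iupd g k mg g0 gle kD; rewrite /upd /mupd_; case: eqP => [ki|_ _]; last exact: fm.
    by rewrite ki => ig; rewrite fineK //; apply: integrable_fin_num.
  - by rewrite /upd; case: eqP => // /eqP ki; apply: f0; rewrite inE negb_or ki.
have [iD|iD] := boolP (i \in D); last first.
  have ne k : k \in D -> k == i = false by move=> kD; apply/negbTE; apply: contra iD => /eqP <-.
  have := IHg fp mfp fp0 fple; rewrite (eq_bigr m) => [<-|k kD]; last by rewrite /mupd_ ne.
  by apply: eq_integral => w _; congr (_%:E); apply: eq_bigr => k kD; rewrite /upd ne.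
have iprod (g : Y -> R) : measurable_fun setT g -> (forall y, 0 <= g y) -> (forall y, g y <= `|f i y|) ->
    P.-integrable setT (fun w => (\prod_(k in D) upd g k (Z k w))%:E).
  by move=> mg g0 gle; apply: integrable_prod => k; [exact: mupd|exact: iupd].
rewrite (eq_integral (fun w => (\prod_(k in D) upd fp k (Z k w))%:E -
    (\prod_(k in D) upd fn k (Z k w))%:E)%E); last first.
  move=> w _; rewrite -EFinB; congr (_%:E).
  rewrite (bigD1 i) //= [X in _ = X - _](bigD1 i) //= [X in _ = _ - X](bigD1 i) //=.
  rewrite /upd eqxx fE mulrBl; congr (_ * _ - _ * _);
    by apply: eq_bigr => k /andP[_ /negbTE ->].
rewrite integralB //; [|exact: iprod|exact: iprod].
rewrite !IHg // -EFinB; congr (_%:E).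
rewrite (bigD1 i) //= [X in _ - X](bigD1 i) //= [RHS](bigD1 i) //= /mupd_ eqxx.
have mE : m i = fine (\int[P]_w (fp (Z i w))%:E)%E - fine (\int[P]_w (fn (Z i w))%:E)%E.
  have ip : P.-integrable setT (fun w => (fp (Z i w))%:E).
    by have := iupd fp i mfp fp0 fple iD; rewrite /upd eqxx.
  have in_ : P.-integrable setT (fun w => (fn (Z i w))%:E).
    by have := iupd fn i mfn fn0 fnle iD; rewrite /upd eqxx.
  have := fm i iD; under eq_integral do rewrite fE EFinB.
  rewrite integralB // => E.
  rewrite -fineB; last 2 first.
  - exact: integrable_fin_num.
  - exact: integrable_fin_num.
  by rewrite E.
rewrite mE mulrBl; congr (_ * _ - _ * _); by apply: eq_bigr => k /andP[_ /negbTE ->].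
Qed.

Lemma expectation_prod (f : K -> Y -> R) (m : K -> R) :
  (forall k, measurable_fun setT (f k)) ->
  (forall k, k \in D -> P.-integrable setT (fun w => (f k (Z k w))%:E)) ->
  (forall k, k \in D -> (\int[P]_w (f k (Z k w))%:E = (m k)%:E)%E) ->
  P.-integrable setT (fun w => (\prod_(k in D) f k (Z k w))%:E) /\
  (\int[P]_w (\prod_(k in D) f k (Z k w))%:E = (\prod_(k in D) m k)%:E)%E.
Proof.
move=> mf fi fm; split; first exact: integrable_prod.
by apply: (signed_mixed (s := enum K)) => // k; rewrite mem_enum.
Qed.
End IndependentProducts.

(** * Expected traces *)

(** The Wick formula for independent variables: only equal letters pair, and the recursion on the
    head is the moment recursion of that letter. *)
Lemma prod_gmoment_wick (R : realFieldType) (K : finType) (D : {set K}) (v : K -> R) (l : seq K) :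
  {subset l <= D} ->
  \prod_(k in D) gmoment (v k) (count_mem k l) = wick (fun x y => (x == y)%:R * v x) l.
Proof.
have [m] := ubnP (size l); elim: m l => // m IH [|k l] /= lm lD.
  by rewrite wick_nil big1.
have kD : k \in D by rewrite lD ?mem_head.
have {}lD : {subset l <= D} by move=> x xl; rewrite lD // inE xl orbT.
rewrite wick_cons (bigD1 k) //= eqxx add1n gmomentSS.
have -> : \sum_(y <- l) (k == y)%:R * v k * wick (fun x y => (x == y)%:R * v x) (rem y l) =
    (count_mem k l)%:R * (v k * wick (fun x y => (x == y)%:R * v x) (rem k l)).
  rewrite -sum1_count natr_sum mulr_suml [RHS]big_mkcond /=; apply: eq_bigr => y _.
  by rewrite eq_sym; case: eqP => [->|_]; rewrite ?mul1r // !mul0r.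
rewrite -!mulrA; have [kl|/count_memPn ->] := boolP (k \in l); last by rewrite !mul0r.
congr (_ * (_ * _)); rewrite -IH; last 2 first.
- by rewrite size_rem // (leq_ltn_trans (leq_pred _)).
- by move=> x /mem_rem /lD.
rewrite [RHS](bigD1 k) //=; congr (_ * _).
  by rewrite count_rem kl /= eqxx subn1.
apply: eq_bigr => x /andP[_ xk]; rewrite count_rem kl /= eq_sym (negbTE xk) subn0.
by rewrite add0n.
Qed.

Section Expectation.
Context (d : measure_display) (T : measurableType d) (R : realType) (P : probability T R).
Implicit Types (f g : T -> R).

Definition has_expectation f (v : R) :=
  P.-integrable setT (EFin \o f) /\ (\int[P]_w (f w)%:E = v%:E)%E.

Lemma has_expectation_ext f g v : (forall w, f w = g w) ->
  has_expectation f v -> has_expectation g v.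
Proof. by move=> /funext ->. Qed.

Lemma has_expectationD f g v u : has_expectation f v -> has_expectation g u ->
  has_expectation (fun w => f w + g w) (v + u).
Proof.
move=> [fi fv] [gi gu]; split; first by apply: (integrableD measurableT fi gi).
under eq_integral do rewrite EFinD.
by rewrite integralD // fv gu.
Qed.

Lemma has_expectationZ f v c : has_expectation f v -> has_expectation (fun w => c * f w) (c * v).
Proof.
move=> [fi fv]; split; first by apply: (integrableZl measurableT c fi).
under eq_integral do rewrite EFinM.
by rewrite integralZl // fv.
Qed.

Lemma has_expectation0 : has_expectation (fun=> 0) 0.
Proof. by split; [exact: integrable0|rewrite integral0]. Qed.

Lemma has_expectation_sum (J : Type) (s : seq J) (Q : pred J) (f : J -> T -> R) (v : J -> R) :
  (forall j, has_expectation (f j) (v j)) ->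
  has_expectation (fun w => \sum_(j <- s | Q j) f j w) (\sum_(j <- s | Q j) v j).
Proof.
move=> fv; elim: s => [|j s IH].
  by rewrite big_nil; apply: has_expectation_ext has_expectation0 => w; rewrite big_nil.
rewrite big_cons; case: ifP => Qj; last by apply: has_expectation_ext IH => w; rewrite big_cons Qj.
by apply: has_expectation_ext (has_expectationD (fv j) IH) => w; rewrite big_cons Qj.
Qed.
End Expectation.

(** * Entries as combinations of independent real Gaussians *)

Section RealFamily.
Context (d : measure_display) (T : measurableType d) (R : realType) (P : probability T R)
  (n : nat) (b : 'M[R]_n) (X : T -> 'M[R[i]]_n).
Hypothesis b_sym : forall i j, b i j = b j i.
Hypothesis X_gauss : gaussian_hermitian P b X.

Let I := 'I_n.
Let K := (I * I * bool)%type.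
Let D0 : {set I * I} := [set ij : I * I | (ij.2 <= ij.1)%N]%SET.
Let D : {set K} := [set k : K | k.1 \in D0]%SET.

Let g (k : K) (w : T) : R :=
  if k.2 then complex.Re (X w k.1.1 k.1.2) else complex.Im (X w k.1.1 k.1.2).

(** The imaginary part of a diagonal entry counts as a Gaussian of variance 0, so that every entry
    has two coordinates. *)
Let sd (k : K) : R :=
  if k.1.1 == k.1.2 then (if k.2 then b k.1.1 k.1.2 else 0)
  else b k.1.1 k.1.2 / Num.sqrt 2.

Let Im_diag w i : complex.Im (X w i i) = 0.
Proof.
case: X_gauss => [/(_ w i i) + _ _ _]; case: (X w i i) => x y.
move=> /(congr1 (@complex.Im R)) E; have {}E : y = - y := E.
by move=> /=; lra.
Qed.

Let has_law0 (Z : T -> R) : (forall w, Z w = 0) -> has_law P Z (gaussR (0 : R)).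
Proof.
move=> Z0; have -> : Z = cst 0 by apply/funext.
split=> [|A mA]; first exact: measurable_cst.
rewrite /gaussR eqxx diracE preimage_cst.
by case: ifP => _; rewrite ?probability_setT ?measure0.
Qed.

Lemma g_law k : k \in D -> has_law P (g k) (gaussR (sd k)).
Proof.
case: k => [[i j] c]; rewrite !inE /sd /g /= => ji.
case: X_gauss => _ _ Xoff Xdiag; case: eqP => [->|/eqP ij].
  by case: c; [exact: Xdiag|apply: has_law0 => w; exact: Im_diag].
have ji' : (j < i)%N by rewrite ltn_neqAle ji andbT eq_sym (inj_eq val_inj).
have [lre lim _] := Xoff i j ji'.
by case: c; [exact: lre|exact: lim].
Qed.

Lemma g_measurable k : k \in D -> measurable_fun setT (g k).
Proof. by move=> /g_law[]. Qed.

(** Entries are independent as pairs, and rectangles split further: off the diagonal by independence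
    of the two parts, on it because the imaginary part is constant. *)
Lemma g_indep (A : K -> set R) : (forall k, measurable (A k)) ->
  P (\bigcap_(k in [set` D]) (g k @^-1` A k)) = (\prod_(k in D) P (g k @^-1` A k))%E.
Proof.
move=> mA; case: X_gauss => _ Xind Xoff _.
pose B (e : I * I) : set (R * R) := A (e, true) `*` A (e, false).
have mB e : measurable (B e) by exact: measurableX.
have BE e : (fun w => ReIm (X w e.1 e.2)) @^-1` B e = g (e, true) @^-1` A (e, true) `&` g (e, false) @^-1` A (e, false).
  by [].
have -> : \bigcap_(k in [set` D]) (g k @^-1` A k) =
    \bigcap_(e in [set` D0]) ((fun w => ReIm (X w e.1 e.2)) @^-1` B e).
  apply/seteqP; split => w H.
    by move=> e eD; rewrite BE; split; apply: H; rewrite /= inE.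
  move=> [e c] /=; rewrite inE /= => eD; have [Ht Hf] := H e eD.
  by case: c.
rewrite (Xind D0 B (subxx _) (fun k _ => mB k)).
transitivity (\prod_(e in D0) \prod_(c : bool) P (g (e, c) @^-1` A (e, c)))%E; last first.
  rewrite pair_big /=; apply: eq_big => [[e c]|[e c] _] //=; first by rewrite !inE andbT.
apply: eq_bigr => -[i j] ijD; have ji : (j <= i)%N by move: ijD; rewrite inE.
rewrite BE big_bool /=.
have [ij|ij] := eqVneq i j; last first.
  have ji' : (j < i)%N by rewrite ltn_neqAle ji andbT eq_sym (inj_eq val_inj).
  by have [_ _ ind] := Xoff i j ji'; exact: ind.
have -> : g (i, j, false) = cst 0 by apply/funext => w; rewrite /g /= ij Im_diag.
rewrite preimage_cst; case: ifP => _; first by rewrite setIT probability_setT mule1.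
by rewrite setI0 measure0 mule0.
Qed.

Let mono (l : seq K) (w : T) : R := \prod_(k <- l) g k w.

Lemma mono_moment l : {subset l <= D} ->
  P.-integrable setT (fun w => (mono l w)%:E) /\
  (\int[P]_w (mono l w)%:E = (wick (fun x y => (x == y)%:R * sd x ^+ 2) l)%:E)%E.
Proof.
move=> lD; rewrite -(prod_gmoment_wick (fun k => sd k ^+ 2) lD).
have E w : mono l w = \prod_(k in D) g k w ^+ count_mem k l.
  rewrite /mono; elim: (l) lD => [|k s IH] lD; first by rewrite big_nil big1.
  have kD : k \in D by rewrite lD ?mem_head.
  rewrite big_cons IH => [|x xs]; last by rewrite lD // inE xs orbT.
  rewrite (bigD1 k) //= [RHS](bigD1 k) //= eqxx add1n exprS mulrA; congr (_ * _).
  by apply: eq_bigr => x /andP[_ xk]; rewrite eq_sym (negbTE xk) add0n.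
have -> : (fun w => (mono l w)%:E) = (fun w => (\prod_(k in D) g k w ^+ count_mem k l)%:E).
  by apply/funext => w; rewrite E.
apply: (expectation_prod g_measurable g_indep (f := fun k x => x ^+ count_mem k l)) => k.
- exact: measurable_funX.
- by move=> kD; have [] := gauss_moment (g_law kD) (count_mem k l).
- by move=> kD; have [] := gauss_moment (g_law kD) (count_mem k l).
Qed.

Let C := R[i].
Local Notation rc := (real_complex R).
(** Entries above the diagonal are read from their mirror image, with the imaginary part negated
    through [alpha]. *)
Let e (x : I * I) (c : bool) : K := (if (x.2 <= x.1)%N then x else (x.2, x.1), c).
Let alpha (x : I * I) (c : bool) : C :=
  if c then 1 else if (x.2 <= x.1)%N then 'i%C else - 'i%C.

Let eD x c : e x c \in D.
Proof. by rewrite !inE /e /=; case: (leqP x.2 x.1) => //= /ltnW. Qed.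

Let X_expand w x : X w x.1 x.2 = \sum_c alpha x c * rc (g (e x c) w).
Proof.
rewrite big_bool /alpha /e /= mul1r /g /=; case: leqP => xx /=; first exact: complexE.
case: X_gauss => [-> _ _ _]; case: (X w x.2 x.1) => u v /=.
by rewrite [LHS]complexE /= rmorphN mulrN mulNr.
Qed.

Let beta (i j : I) : R := b i j ^+ 2.

Let wordX (w : seq (I * I)) (t : T) : C := \prod_(x <- w) X t x.1 x.2.

Let emb (x : I * I) : letter I := (x.1, Some x.2).

Let wordX_expand p w t : rc p * wordX w t = multiexpand alpha e w (fun l => rc (p * mono l t)).
Proof.
elim: w p => [|x w IH] p; first by rewrite /wordX /mono /= !big_nil !mulr1.
rewrite /wordX big_cons -/(wordX w t) X_expand mulr_suml mulr_sumr /=.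
apply: eq_bigr => c _; rewrite mulrCA -!mulrA; congr (_ * _).
rewrite mulrA -rmorphM IH; apply: eq_multiexpand => l.
by rewrite /mono big_cons [in RHS]mulrA (mulrC p).
Qed.

Let alpha_mul x y : alpha x false * alpha y false =
  rc (if (x.2 <= x.1)%N == (y.2 <= y.1)%N then -1 else 1).
Proof.
have ii : ('i%C : C) * 'i%C = -1 by rewrite complexiE -expr2 sqrCi.
by rewrite /alpha; case: (x.2 <= x.1)%N; case: (y.2 <= y.1)%N;
  rewrite /= ?mulrN ?mulNr ?ii ?opprK ?rmorphN ?rmorph1.
Qed.

(** Off the diagonal the two parts contribute [b^2 / 2] each: they add up for mirror entries and
    cancel in the square of an entry, as ['i] squares to -1. On the diagonal only the real part
    counts. *)
Let cov_words x y :
  \sum_c alpha x c * \sum_c' alpha y c' * rc ((e x c == e y c')%:R * sd (e x c) ^+ 2) =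
  rc (cov beta (emb x) (emb y)).
Proof.
have -> : \sum_c alpha x c * \sum_c' alpha y c' * rc ((e x c == e y c')%:R * sd (e x c) ^+ 2) =
    alpha x true * alpha y true * rc ((e x true == e y true)%:R * sd (e x true) ^+ 2) +
    alpha x false * alpha y false * rc ((e x false == e y false)%:R * sd (e x false) ^+ 2).
  rewrite !big_bool /= (_ : e x true == e y false = false) ?mul0r; last by rewrite xpair_eqE andbF.
  rewrite (_ : e x false == e y true = false) ?mul0r; last by rewrite xpair_eqE andbF.
  by rewrite rmorph0 !mulr0 addr0 add0r !mulrA.
rewrite alpha_mul {1 2}/alpha mulr1 mul1r -rmorphM -rmorphD; congr rc.
have half z : (z / Num.sqrt 2) ^+ 2 = z ^+ 2 / 2 :> R by rewrite expr_div_n sqr_sqrtr.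
case: x y => [i j] [k l]; rewrite /cov /emb /beta /e /sd /= !xpair_eqE !andbT.
rewrite !(inj_eq (@Some_inj _)).
case: (leqP j i) => ji; case: (leqP l k) => lk /=.
- rewrite xpair_eqE; have [<-|ij] := eqVneq i j.
    rewrite expr0n /= !mulr0 addr0 (eq_sym l i).
    by have [<-|_] := eqVneq i k; case: (i == l); rewrite ?mulr1 ?mul1r ?mulr0 ?mul0r.
  rewrite mulN1r subrr; case: eqP => [jk|_]; last by rewrite mulr0 mul0r.
  case: eqP => [li|_]; last by rewrite mulr0.
  by move: ij; rewrite -val_eqE eqn_leq ji jk -li lk.
- rewrite xpair_eqE mul1r -mulrDr (eq_sym l i).
  have [jk|_] := eqVneq j k; last by rewrite andbF mulr0 !mul0r.
  have [il|_] := eqVneq i l; last by rewrite mul0r mulr0.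
  have ij : i == j = false by apply/negbTE; rewrite jk il -val_eqE neq_ltn lk orbT.
  by rewrite ij /= half -jk; field.
- rewrite xpair_eqE mul1r -mulrDr (eq_sym l i).
  have [il|_] := eqVneq i l; last by rewrite mulr0 andbF mul0r.
  have [jk|_] := eqVneq j k; last by rewrite !mul0r mulr0 mul0r.
  have ij : j == i = false by apply/negbTE; rewrite -val_eqE neq_ltn ji orbT.
  by rewrite ij /= half -jk b_sym; field.
- have ij : j == i = false by apply/negbTE; rewrite -val_eqE neq_ltn ji orbT.
  rewrite ij mulN1r subrr; case: eqP => [jk|_]; last by rewrite mulr0 mul0r.
  case: eqP => [li|_]; last by rewrite mulr0.
  by move: lk; rewrite -jk li ltnNge ltnW.
Qed.

Let wick_words w : wick (cov beta) (map emb w) = 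
  complex.Re (multiexpand alpha e w (fun l => rc (wick (fun x y => (x == y)%:R * sd x ^+ 2) l))).
Proof.
rewrite (eq_multiexpand _ _ _ (F' := wick (fun x y => rc ((x == y)%:R * sd x ^+ 2)))); last first.
  by move=> l; exact: (wick_rmorph (real_complex R)).
rewrite multiexpand_wick; last by move=> x y; rewrite eq_sym; case: eqP => [->|]; rewrite ?mul0r.
rewrite (eq_wick _ cov_words) -(wick_rmorph (real_complex R)) /=.
by apply: wick_map => // -[x x'] [y y'] [-> ->].
Qed.

Let wordX_expectation w :
  has_expectation P (fun t => complex.Re (wordX w t)) (wick (cov beta) (map emb w)).
Proof.
(* Stated for any [G] and [c], which take up the letters and coefficients already expanded in the
   induction. *)
have main (G : seq K -> T -> R) (v : seq K -> R) c :
    (forall l, {subset l <= D} -> has_expectation P (G l) (v l)) ->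
    has_expectation P (fun t => complex.Re (c * multiexpand alpha e w (fun l => rc (G l t))))
      (complex.Re (c * multiexpand alpha e w (fun l => rc (v l)))).
  elim: w G v c => [|x w IH] G v c Gv.
    have ReM (z : C) y : complex.Re (z * rc y) = complex.Re z * y.
      by case: z => z z' /=; rewrite mulr0 subr0.
    rewrite -[multiexpand _ _ _ _]/(rc (v [::])) ReM; apply: has_expectation_ext (has_expectationZ (complex.Re c) (Gv [::] _)) => // t.
    by rewrite -[multiexpand _ _ _ _]/(rc (G [::] t)) ReM.
  rewrite [multiexpand _ _ _ _]/= mulr_sumr raddf_sum.
  apply: has_expectation_ext (has_expectation_sum _ _ (f := fun b t => complex.Re (c * alpha x b * multiexpand alpha e w (fun l => rc (G (e x b :: l) t)))) (v := _) _).
    by move=> t; rewrite [multiexpand _ _ _ _]/= mulr_sumr raddf_sum; apply: eq_bigr => b' _; rewrite mulrA.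
  move=> b'; rewrite mulrA; apply: IH => l lD; apply: Gv => k.
  by rewrite inE => /orP[/eqP ->|/lD].
have := main mono (wick (fun x y => (x == y)%:R * sd x ^+ 2)) 1 _.
rewrite mul1r -wick_words => H.
apply: has_expectation_ext (H _) => [t|l lD]; last exact: mono_moment.
rewrite mul1r -[wordX w t]mul1r -[1]/(rc 1) wordX_expand; congr complex.Re.
by apply: eq_multiexpand => l; rewrite mul1r.
Qed.

(** The word [w] holds the steps already made, like [M] in [walks]. *)
Lemma trace_word_expectation r L a w :
  has_expectation P (fun t => complex.Re ((X t ^+ L) a r * wordX w t))
    (walks beta r L a (map emb w)).
Proof.
elim: L a w => [|L IH] a w /=.
  apply: has_expectation_ext (has_expectationZ (a == r)%:R (wordX_expectation w)) => t.
  by rewrite expr0 mxE; case: eqP => _; rewrite ?mul1r ?mul0r.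
apply: has_expectation_ext (has_expectation_sum _ _ (f := fun c t => complex.Re ((X t ^+ L) c r * wordX ((a, c) :: w) t)) (fun c => IH c ((a, c) :: w))) => t.
rewrite exprS mxE mulr_suml raddf_sum; apply: eq_bigr => c _; congr complex.Re.
by rewrite /wordX big_cons mulrCA mulrA.
Qed.

Lemma trace_expectation L :
  has_expectation P (fun t => complex.Re (\tr (X t ^+ L))) (\sum_r walks beta r L r [::]).
Proof.
apply: has_expectation_ext (has_expectation_sum _ _ (f := fun r t => complex.Re ((X t ^+ L) r r * wordX [::] t)) (fun r => trace_word_expectation r L r [::])) => t.
by rewrite /mxtrace raddf_sum; apply: eq_bigr => r _; rewrite /wordX big_nil mulr1.
Qed.
End RealFamily.

(** * Tail bound *)

(** This is [exp x <= 2 cosh x], the source of the factor 2 in the tail bound. Assuming a bound on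
    partial sums only lets Markov's inequality be applied to finite sums of traces. *)
Lemma expR_le_even_series (R : realType) (x p U : R) : 0 <= p ->
  (forall M, p * \sum_(k < M) x ^+ k.*2 / (k.*2)`!%:R <= U) -> p * expR x <= 2 * U.
Proof.
move=> p0 pU; pose S y N := series (exp_coeff y) N : R.
have SE y N : S y N = \sum_(k < N) y ^+ k / k`!%:R by rewrite /S /series /= big_mkord.
have S2 N : S x N.*2 + S (- x) N.*2 = 2 * \sum_(k < N) x ^+ k.*2 / (k.*2)`!%:R.
  rewrite !SE; elim: N => [|N IH]; first by rewrite !big_ord0 mulr0 addr0.
  rewrite doubleS !big_ord_recr /= mulrDr -IH.
  have -> : (- x) ^+ N.*2 = x ^+ N.*2 by rewrite exprNn -signr_odd odd_double mul1r.
  have -> : (- x) ^+ N.*2.+1 = - x ^+ N.*2.+1.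
    by rewrite exprNn -signr_odd /= odd_double expr1 mulN1r.
  ring.
have cS y : S y N.*2 @[N --> \oo] --> expR y.
  apply: (cvg_comp (fun N => N.*2) (S y)); last exact: is_cvg_series_exp_coeff.
  apply/cvgnyPge => N0; near=> N; apply: (@leq_trans N); last by rewrite -addnn leq_addr.
  by near: N; exact: nbhs_infty_ge.
have cL : p * (S x N.*2 + S (- x) N.*2) @[N --> \oo] --> p * (expR x + expR (- x)).
  by apply: cvgM; [exact: cvg_cst|exact: cvgD].
have le2 : p * (expR x + expR (- x)) <= 2 * U.
  rewrite -(cvg_lim _ cL) //; apply: limr_le; first by apply/cvg_ex; eexists; exact: cL.
  near=> N.
  by rewrite S2 mulrCA ler_wpM2l.
apply: le_trans le2; rewrite ler_wpM2l // lerDl expR_ge0 //.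
Unshelve. all: by end_near. Qed.

Section Tail.
Context (d : measure_display) (T : measurableType d) (R : realType)
    (P : probability T R) (n : nat) (b : 'M[R]_n) (X : T -> 'M[R[i]]_n).
Hypothesis b_sym : forall i j : 'I_n, b i j = b j i.
Hypothesis X_gauss : gaussian_hermitian P b X.
Hypothesis n_gt0 : (0 < n)%N.

Let tr p w : R := complex.Re (\tr (X w ^+ p.*2)).
Let beta (i j : 'I_n) := b i j ^+ 2.
Let moment p := \sum_r walks beta r p.*2 r [::].

Let X_herm w i j : X w i j = Num.conj (X w j i).
Proof. by case: X_gauss => + _ _ _; exact. Qed.

Let tr_moment p : has_expectation P (tr p) (moment p).
Proof. exact: (trace_expectation b_sym X_gauss p.*2). Qed.

Let tr_measurable p : measurable_fun setT (tr p).
Proof. by have [/measurable_int/measurable_EFinP + _] := tr_moment p. Qed.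

Lemma sqr_sigma : sigma b ^+ 2 = \big[Num.max/0]_(i < n) \sum_(j < n) b i j ^+ 2.
Proof.
rewrite sqr_sqrtr //; exact: bigmax_ge_id.
Qed.

Lemma row_le_sigma i : \sum_(j < n) b i j ^+ 2 <= sigma b ^+ 2.
Proof. by rewrite sqr_sigma; exact: le_bigmax. Qed.

Lemma entry_le_sigma_star i j : b i j ^+ 2 <= sigma_star b ^+ 2.
Proof.
rewrite sqr_sqrtr; last exact: bigmax_ge_id.
apply: (le_trans (le_bigmax _ (fun j => b i j ^+ 2) j)).
exact: (le_bigmax _ (fun i => \big[Num.max/0]_(j < n) b i j ^+ 2) i).
Qed.

Lemma moment_le p : moment p <= n%:R * \sum_(j < p.*2.+1)
  (sigma b ^+ 2) ^+ j * (('C(p.*2, j) * (p.*2 - j) ^_ j)%:R *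
    gmoment (sigma_star b ^+ 2) (p.*2 - j - j)) / j`!%:R.
Proof.
rewrite mulr_natl -[X in _ *+ X]card_ord -sumr_const.
apply: ler_sum => r _; apply: walks_le.
- by move=> i j; rewrite /beta b_sym.
- by move=> i j; rewrite /beta sqr_ge0.
- by move=> i j; exact: entry_le_sigma_star.
- move=> j; rewrite /beta; under eq_bigr do rewrite b_sym; exact: row_le_sigma.
Qed.

Lemma measurable_norm_gt a : 0 <= a -> measurable [set w | a < spectral_norm (X w)].
Proof.
move=> a0.
have -> : [set w | a < spectral_norm (X w)] =
    \bigcup_k \bigcap_p [set w | (a + k.+1%:R^-1) ^+ p.*2 <= tr p w].
  apply/seteqP; split => w /=.
    by move=> /(lt_spectral_norm (X_herm w) a0 n_gt0)[k kX]; exists k => // p _; exact: kX.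
  by move=> [k _ kX]; apply/(lt_spectral_norm (X_herm w) a0 n_gt0); exists k => p; exact: kX.
apply: bigcup_measurable => k _; apply: bigcap_measurable => // p _.
have -> : [set w | (a + k.+1%:R^-1) ^+ p.*2 <= tr p w] =
    setT `&` tr p @^-1` `[(a + k.+1%:R^-1) ^+ p.*2, +oo[%classic.
  by rewrite setTI; apply/seteqP; split => w /=; rewrite in_itv /= andbT.
by apply: tr_measurable => //; exact: measurable_itv.
Qed.

(** Markov's inequality for truncations of [Tr cosh(theta X)]: on the event, the trace of the power
    [2p] is at least [a^(2p)]. *)
Lemma markov_exp a theta : 0 <= a -> 0 <= theta ->
  fine (P [set w | a < spectral_norm (X w)]) * expR (theta * a) <=
  2 * (n%:R * expR (2 * (theta * sigma b) + theta ^+ 2 * sigma_star b ^+ 2 / 2)).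
Proof.
move=> a0 t0; set E := [set w | _].
have mE : measurable E by exact: measurable_norm_gt.
apply: expR_le_even_series; first by rewrite fine_ge0.
move=> M; pose f w := \sum_(p < M) theta ^+ p.*2 / (p.*2)`!%:R * tr p w.
have [fi fE] : has_expectation P f (\sum_(p < M) theta ^+ p.*2 / (p.*2)`!%:R * moment p).
  by apply: has_expectation_sum => p; apply: has_expectationZ.
have le1 : \sum_(p < M) theta ^+ p.*2 / (p.*2)`!%:R * moment p <=
    n%:R * expR (2 * (theta * sigma b) + theta ^+ 2 * sigma_star b ^+ 2 / 2).
  have := generating_le M (ler0n _ n) (sqr_ge0 (sigma b)) (sqr_ge0 (sigma_star b)) t0 moment_le.
  by rewrite sqrtr_sqr ger0_norm ?sqrtr_ge0.
apply: le_trans le1; rewrite -lee_fin -fE EFinM fineK ?fin_num_measure //.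
set c := \sum_(k < M) _.
have c0 : 0 <= c by apply: sumr_ge0 => k _; rewrite divr_ge0 // exprn_ge0 // mulr_ge0.
rewrite muleC -[X in P X]setIT -integral_indic // -ge0_integralZl_EFin //; last first.
  by apply/measurable_EFinP; exact: measurable_indic.
have trge p w : spectral_norm (X w) ^+ p.*2 <= tr p w.
  by have /andP[] := trace_even_bounds (X_herm w) p n_gt0.
have sn0 w : 0 <= spectral_norm (X w) by exact: (spectral_norm_ge0 (X_herm w) n_gt0).
apply: ge0_le_integral => //.
- by move=> w _; rewrite -EFinM lee_fin mulr_ge0.
- by apply: measurable_funeM; apply/measurable_EFinP; exact: measurable_indic.
- exact: measurable_int fi.
move=> w _; rewrite -EFinM lee_fin indicE; have [wE|wE] := boolP (w \in E); last first.
  rewrite mulr0; apply: sumr_ge0 => p _; rewrite mulr_ge0 //.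
    by rewrite divr_ge0 // exprn_ge0.
  by apply: le_trans (trge p w); rewrite exprn_ge0.
rewrite mulr1; apply: ler_sum => p _.
rewrite exprMn mulrAC ler_wpM2l //; first by rewrite divr_ge0 // exprn_ge0.
apply: le_trans (trge p w); rewrite lerXn2r ?nnegrE // ltW //.
by move: wE; rewrite inE.
Qed.

(** Here the choice [theta = t / sigma_star] breaks down; instead the second moment vanishes, hence
    so does [Tr X^2] almost everywhere. *)
Lemma norm_gt0_null : sigma_star b = 0 -> P [set w | 0 < spectral_norm (X w)] = 0%E.
Proof.
move=> s0.
have b0 i j : b i j ^+ 2 = 0.
  by apply/eqP; rewrite eq_le sqr_ge0 andbT -[leRHS](expr0n R 2) -s0 entry_le_sigma_star.
have sig0 : sigma b ^+ 2 = 0.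
  apply/eqP; rewrite eq_le sqr_ge0 andbT sqr_sigma; apply: bigmax_le => // i _.
  by rewrite big1.
have m1 : moment 1 <= 0.
  apply: (le_trans (moment_le 1)); rewrite mulr_ge0_le0 // big1 // => -[j jlt] _ /=.
  rewrite sig0 s0; case: j jlt => [|j] _; last by rewrite expr0n /= !mul0r.
  by rewrite expr0n /gmoment /= (expr0n R 2) /= !(mulr0, mul0r).
have tr0 w : 0 <= tr 1 w.
  have /andP[+ _] := trace_even_bounds (X_herm w) 1 n_gt0; apply: le_trans.
  by rewrite exprn_ge0 // (spectral_norm_ge0 (X_herm w) n_gt0).
have [_ trE] := tr_moment 1.
have i0 : (\int[P]_w `|(tr 1 w)%:E| = 0)%E.
  under eq_integral do rewrite abse_EFin ger0_norm //.
  apply/eqP; rewrite eq_le integral_ge0 ?andbT => [|w _]; last by rewrite lee_fin.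
  by rewrite trE lee_fin.
have /ae_eq_integral_abs : measurable_fun setT (fun w => (tr 1 w)%:E) by exact/measurable_EFinP.
move=> /(_ P measurableT) [/(_ i0) [N [mN PN subN]] _].
apply/eqP; rewrite eq_le measure_ge0 andbT -PN le_measure ?inE //; first exact: measurable_norm_gt.
move=> w /= wX; apply: subN => /= /(_ I) [] /eqP; apply/negP; rewrite gt_eqF //.
have /andP[+ _] := trace_even_bounds (X_herm w) 1 n_gt0; apply: lt_le_trans.
by rewrite exprn_gt0.
Qed.
End Tail.

Theorem theorem2p4 (d : measure_display) (T : measurableType d) (R : realType)
    (P : probability T R) (n : nat) (b : 'M[R]_n) (X : T -> 'M[R[i]]_n)
    (b_ge0 : forall i j : 'I_n, 0 <= b i j)
    (b_sym : forall i j : 'I_n, b i j = b j i)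
    (X_gauss : gaussian_hermitian P b X)
    (t : R) (t_ge0 : 0 <= t) :
  (P [set w : T |
        (2 * sigma b + sigma_star b * (1 + t) < spectral_norm (X w))%R]
     <= (2 * n%:R * expR (- (t ^+ 2 / 2)))%:E)%E.
Proof.
have s0 : 0 <= sigma b by exact: sqrtr_ge0.
have s'0 : 0 <= sigma_star b by exact: sqrtr_ge0.
have a0 : 0 <= 2 * sigma b + sigma_star b * (1 + t).
  by rewrite addr_ge0 ?mulr_ge0 // addr_ge0.
have [n0|n_gt0] := posnP n.
  rewrite (_ : [set w | _] = set0) ?measure0; last first.
    apply/seteqP; split => // w /=; apply/negP; rewrite -leNgt.
    by move: a0 (X w); move: (2 * sigma b + _) => a a0; rewrite n0 => Xw; rewrite spectral_norm_dim0.
  by rewrite lee_fin mulr_ge0 ?expR_ge0 // mulr_ge0.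
have [z|s'_neq0] := eqVneq (sigma_star b) 0.
  apply: (@le_trans _ _ 0%E); last by rewrite lee_fin mulr_ge0 ?expR_ge0 // mulr_ge0.
  rewrite -(norm_gt0_null b_sym X_gauss n_gt0 z).
  apply: le_measure; rewrite ?inE; try exact: (measurable_norm_gt b_sym X_gauss).
  by move=> w /=; exact: le_lt_trans.
have s'_gt0 : 0 < sigma_star b by rewrite lt_def s'_neq0.
have th0 : 0 <= t / sigma_star b by rewrite divr_ge0.
have := markov_exp b_sym X_gauss n_gt0 a0 th0.
set a := 2 * sigma b + _; set E := [set w | _]; set s := sigma_star b; set th := t / s.
have mE : measurable E by exact: (measurable_norm_gt b_sym X_gauss).
rewrite -ler_pdivlMr ?expR_gt0 // -expRN => le1.
rewrite -(fineK (fin_num_measure P E mE)) lee_fin; apply: (le_trans le1).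
rewrite [2 * (_ * _)]mulrA -[leLHS]mulrA -expRD ler_wpM2l ?mulr_ge0 // ler_expR.
have ths : th * s = t by rewrite /th divfK.
have -> : th ^+ 2 * s ^+ 2 = t ^+ 2 by rewrite -exprMn ths.
have -> : th * a = 2 * (th * sigma b) + t * (1 + t).
  by rewrite /a -/s -ths; ring.
(* What remains is [t^2 / 2 - t (1 + t) <= - t^2 / 2], that is [0 <= t]. *)
nra.
Qed.
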